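(* Let $E_X,E_Y$ be Polish spaces, $H:E_X\times E_Y\to\mathbb{R}$ bounded and continuous, $\mathcal{H}_X:=\{H(\cdot,y):y\in E_Y\}$, $\mathcal{H}_Y:=\{H(x,\cdot):x\in E_X\}$, $G_Y:\mathcal{H}_Y\to\mathcal{C}_b(E_Y)$, $\beta\in\mathcal{C}_b(E_Y)$. Suppose that for each $y\in E_Y$ there is an $E_Y$-valued Markov process $Y$ with a strongly continuous semigroup, which is the unique solution of the $(G_Y,\mathcal{H}_Y,y)$-martingale problem. Let $(P_t)_{t\ge0}$ be the semigroup defined on the closure of $\mathrm{span}(\mathcal{H}_X)$ and given by $$P_tH(\cdot,y):=\mathbb{E}_y\Big[H(\cdot,Y_t)\exp\Big(\int_0^t\beta(Y_s)\,ds\Big)\Big],$$ and assume that its generator $G_X$ has domain $\mathcal{D}_X\supseteq\mathcal{H}_X$ and satisfies $G_XH(\cdot,y)(x)=G_YH(x,\cdot)(y)+\beta(y)H(x,y)$ for all $x\in E_X$, $y\in E_Y$. Assume that $E_X$ is compact, that $\mathrm{span}(\mathcal{H}_X)\subseteq\mathcal{C}(E_X)$ is a convergence determining algebra (i.e. it is closed under multiplication) containing $1$, and that the semigroup of $Y$ is $\mathcal{C}_b(E_Y)$-Feller. In addition, let $X^1,X^2,\dots$ be Markov processes with state space $E_X$ and $Y^1,Y^2,\dots$ Markov processes with state space $E_Y$ such that for each $n$, $X^n$ and $Y^n$ are in $H$-duality with potential $\beta$, i.e. $$\mathbb{E}_x[H(X^n_t,y)]=\mathbb{E}_y\Big[H(x,Y^n_t)\exp\Big(\int_0^t\beta(Y^n_r)\,dr\Big)\Big],\qquad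 x\in E_X,\ y\in E_Y,\ t\ge0,$$ and such that $Y^n\Rightarrow Y$ as $n\to\infty$ (convergence in distribution of the processes, for each common starting point $y\in E_Y$). Then for all $t\ge0$ and $x\in E_X$, the linear map $P_t^x:\mathrm{span}(\mathcal{H}_X)\to\mathbb{R}$ given by $$P_t^xH(\cdot,y):=P_tH(\cdot,y)(x)=\mathbb{E}_y\Big[H(x,Y_t)\exp\Big(\int_0^t\beta(Y_s)\,ds\Big)\Big]$$ is positive with $P_t^x1=1$. In particular, there is a family $(\mu_t)_{t\ge0}$ of probability kernels from $E_X$ to $E_X$ such that for all $y\in E_Y$ and $t\ge0$ $$P_tH(\cdot,y)=\int_{E_X}\mu_t(\cdot,dx')\,H(x',y).$$
   Context: For a Polish space $E$: $\mathcal{C}_b(E)$ is the space of bounded continuous real functions ($\mathcal{C}(E)$ if $E$ is compact); $\mathcal{B}(E)$ denotes the bounded measurable real functions; $\mathcal{M}_1(E)$ is the set of Borel probability measures. $\|\cdot\|$ is the supremum norm. $\mathcal{C}_b(E)$ is equipped with bounded pointwise (bp) convergence: $f_n\to f$ iff $\sup_n\|f_n\|<\infty$ and $f_n\to f$ pointwise. A set $\Pi\subseteq\mathcal{C}_b(E)$ is convergence determining if $\int f\,d\mu_n\to\int f\,d\mu$ for all $f\in\Pi$ implies $\mu_n\Rightarrow\mu$ weakly ($\mu,\mu_n\in\mathcal{M}_1(E)$). A linear map is positive if it maps nonnegative functions to nonnegative values. A semigroup on a vector space $\mathcal{D}\subseteq\mathcal{C}_b(E)$ is a family of bounded linear maps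 $P_t:\mathcal{D}\to\mathcal{B}(E)$, $t\ge0$, with $P_t(P_sf)=P_{t+s}f$ for all $s,t\ge0$ and $f\in\mathcal{D}$ with $P_sf\in\mathcal{D}$. It is a contraction if $\|P_tf\|\le\|f\|$, positive if $f\ge0$ implies $P_tf\ge0$, conservative if $P_t1=1$, and strongly continuous if $P_tf\to f$ as $t\to0$ for all $f\in\mathcal{C}_b(E)$. A conservative, positive, strongly continuous contraction semigroup with $P_tf\in\mathcal{C}_b(E)$ for all $f\in\mathcal{C}_b(E)$, $t\ge0$, is called $\mathcal{C}_b(E)$-Feller. The generator of $(P_t)$ is $Gf(x)=\lim_{t\to0}\frac1t(P_tf(x)-f(x))$, its domain being the set of $f$ for which the limit exists boundedly pointwise. The semigroup of a time-homogeneous Markov process $Z$ is $f\mapsto\mathbb{E}_z[f(Z_t)]$; $\mathbb{E}_z$ denotes expectation when the process starts in $z$. Martingale problem: given a linear operator $G$, a set $\mathcal{D}$ of measurable real functions on $E$ on which $G$ is defined, and $z\in E$, the distribution $\mathbb{P}$ of an $E$-valued progressively measurable process $Z$ solves the martingale problem for $(G,\mathcal{D},z)$ if $Z_0=z$ almost surely and $\big(f(Z_t)-\int_0^tGf(Z_s)\,ds\big)_{t\ge0}$ is a $\mathbb{P}$-martingale with respect to the filtration generated by $Z$ for all $f\in\mathcal{D}$. Uniqueness means uniqueness in law. *)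

(* Defs.v *)
From HB Require Import structures.
From mathcomp Require Import all_boot all_order all_algebra.
From mathcomp Require Import all_classical all_reals all_analysis.

Set Implicit Arguments.
Unset Strict Implicit.
Unset Printing Implicit Defensive.

Import Order.TTheory GRing.Theory Num.Theory.
Import numFieldNormedType.Exports.

Local Open Scope classical_set_scope.
Local Open Scope ring_scope.

HB.mixin Record isSeparable (T : Type) & Topological T := {
  separable_subproof : exists2 D : set T, countable D & dense D
}.

(* A Polish space is presented with one of its complete metrics.  It is
   nonempty, as are all measurable types of the library. *)
#[short(type="polishType")]
HB.structure Definition Polish (R : realType) :=
  { T of Complete T & Metric R T & isSeparable T }.

Notation borel E := (g_sigma_algebraType (@open E)).

Section function_spaces.
Context {R : realType} {E : polishType R}.
Implicit Types (f g : E -> R) (A D : set (E -> R)).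

Definition Cb : set (E -> R) := [set f | continuous f /\ bounded_fun f].

Definition Bb : set (E -> R) :=
  [set f | measurable_fun setT (f : borel E -> R) /\ bounded_fun f].

Definition supnorm f : R := sup (range (fun x => `|f x|)).

Definition linear_span A : set (E -> R) :=
  [set f | exists (n : nat) (c : 'I_n -> R) (g : 'I_n -> E -> R),
     (forall i, A (g i)) /\ f = (fun x => \sum_(i < n) c i * g i x)].

Definition bp_cvg {I : Type} (F : set_system I) (f_ : I -> E -> R) f :=
  (exists M : R, \forall i \near F, forall x, `|f_ i x| <= M) /\
  (forall x, f_ i x @[i --> F] --> f x).

Definition bp_closed A :=
  forall (f_ : nat -> E -> R) f,
    (forall n, A (f_ n)) -> Cb f -> bp_cvg \oo f_ f -> A f.

(* Closure in Cb with respect to bounded pointwise convergence; it need not be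
   reached by limits of sequences in A alone. *)
Definition bp_closure A : set (E -> R) :=
  \bigcap_(B in [set B | [/\ A `<=` B, B `<=` Cb & bp_closed B]]) B.

Definition vector_space D :=
  D (fun=> 0) /\
  forall (a : R) f g, D f -> D g -> D (fun x => a * f x + g x).

Definition linear_on (V : lmodType R) D (L : (E -> R) -> V) :=
  forall (a : R) f g, D f -> D g ->
    L (fun x => a * f x + g x) = a *: L f + L g.

Definition positive_functional D (L : (E -> R) -> R) :=
  forall f, D f -> (forall x, 0 <= f x) -> 0 <= L f.

Definition algebra_on D :=
  vector_space D /\ forall f g, D f -> D g -> D (fun x => f x * g x).

Definition weak_cvg (mu_ : nat -> probability (borel E) R)
    (mu : probability (borel E) R) :=
  forall f, Cb f -> \int[mu_ n]_x f x @[n --> \oo] --> \int[mu]_x f x.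

Definition convergence_determining A :=
  A `<=` Cb /\
  forall (mu_ : nat -> probability (borel E) R) (mu : probability (borel E) R),
    (forall f, A f -> \int[mu_ n]_x f x @[n --> \oo] --> \int[mu]_x f x) ->
    weak_cvg mu_ mu.

End function_spaces.

Arguments Cb {R} E.
Arguments Bb {R} E.

Section semigroups.
Context {R : realType} {E : polishType R}.
Implicit Types (D : set (E -> R)) (P : R -> (E -> R) -> (E -> R)).

Record semigroup D P : Prop := {
  semigroup_dom : vector_space D /\ D `<=` Cb E;
  semigroup_Bb : forall t f, 0 <= t -> D f -> Bb E (P t f);
  semigroup_linear : forall t, 0 <= t -> linear_on D (P t);
  semigroup_bounded : forall t, 0 <= t -> exists C : R,
    forall f, D f -> supnorm (P t f) <= C * supnorm f;
  semigroup_comp : forall t s f, 0 <= t -> 0 <= s -> D f -> D (P s f) ->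
    P t (P s f) = P (t + s) f
}.

Definition contraction D P :=
  forall t f, 0 <= t -> D f -> supnorm (P t f) <= supnorm f.

Definition positive_semigroup D P :=
  forall t f, 0 <= t -> D f -> (forall x, 0 <= f x) -> forall x, 0 <= P t f x.

Definition conservative P := forall t, 0 <= t -> P t (fun=> 1) = (fun=> 1).

Definition strongly_continuous P :=
  forall f, Cb E f -> bp_cvg 0^'+ (fun t => P t f) f.

Record Feller P : Prop := {
  Feller_semigroup : semigroup (Cb E) P;
  Feller_conservative : conservative P;
  Feller_positive : positive_semigroup (Cb E) P;
  Feller_continuous : strongly_continuous P;
  Feller_contraction : contraction (Cb E) P;
  Feller_Cb : forall t f, 0 <= t -> Cb E f -> Cb E (P t f)
}.

Definition diff_quotient P (f : E -> R) (t : R) (x : E) : R :=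
  t^-1 * (P t f x - f x).

Definition generator_dom D P : set (E -> R) :=
  [set f | D f /\ exists g, bp_cvg 0^'+ (diff_quotient P f) g].

Definition generator P (f : E -> R) (x : E) : R :=
  lim (diff_quotient P f t x @[t --> 0^'+]).

End semigroups.

Section processes.
Context {R : realType} {E : polishType R} {d : measure_display}
  {Omega : measurableType d}.
Implicit Types (P : probability Omega R) (Z : R -> Omega -> E).

(* Processes are indexed by R; only the times t >= 0 are ever used. *)
Definition process Z :=
  forall t, 0 <= t -> measurable_fun setT (Z t : Omega -> borel E).

Definition filtration_of Z (t : R) : set (set Omega) :=
  <<s \bigcup_(s in `[0, t])
        preimage_set_system setT (Z s : Omega -> borel E) measurable >>.

(* Progressive measurability with respect to the filtration generated by Z. *)
Definition progressive Z :=
  process Z /\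
  forall t : R, 0 <= t ->
    measurable_fun ((`[0, t] : set R) `*` setT)
      (fun p : R * g_sigma_algebraType (filtration_of Z t) =>
         Z p.1 p.2 : borel E).

(* V is a version of the conditional expectation of U given the
   sub-sigma-algebra F. *)
Definition is_cond_exp P (F : set (set Omega)) (U V : Omega -> R) :=
  [/\ P.-integrable setT (EFin \o U),
      P.-integrable setT (EFin \o V),
      (forall B : set R, measurable B -> F (V @^-1` B)) &
      forall A, F A -> \int[P]_(w in A) V w = \int[P]_(w in A) U w].

(* Adaptedness and integrability of M are the case s = t. *)
Definition martingale P (F : R -> set (set Omega)) (M : R -> Omega -> R) :=
  forall s t, 0 <= s -> s <= t -> is_cond_exp P (F s) (M t) (M s).

Definition solves_martingale_problem (G : (E -> R) -> (E -> R))
    (D : set (E -> R)) (z : E) P Z :=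
  [/\ progressive Z,
      {ae P, forall w, Z 0 w = z} &
      forall f, D f ->
        martingale P (filtration_of Z)
          (fun t w => f (Z t w)
             - \int[lebesgue_measure]_(s in `[0, t]) G f (Z s w))].

End processes.

(* Equality in law, as equality of the finite-dimensional distributions. *)
Definition same_law {R : realType} {E : polishType R}
    {d d' : measure_display} {Omega : measurableType d}
    {Omega' : measurableType d'}
    (P : probability Omega R) (Z : R -> Omega -> E)
    (P' : probability Omega' R) (Z' : R -> Omega' -> E) :=
  forall (n : nat) (t : 'I_n -> R) (B : 'I_n -> set (borel E)),
    (forall i, 0 <= t i) -> (forall i, measurable (B i)) ->
    P [set w | forall i, B i (Z (t i) w)] =
    P' [set w | forall i, B i (Z' (t i) w)].

Definition unique_solution_martingale_problem {R : realType} {E : polishType R}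
    (G : (E -> R) -> (E -> R)) (D : set (E -> R)) (z : E)
    {d : measure_display} {Omega : measurableType d}
    (P : probability Omega R) (Z : R -> Omega -> E) :=
  solves_martingale_problem G D z P Z /\
  forall (d' : measure_display) (Omega' : measurableType d')
    (P' : probability Omega' R) (Z' : R -> Omega' -> E),
    solves_martingale_problem G D z P' Z' -> same_law P' Z' P Z.

(* A time-homogeneous Markov process is a process on one measurable space with
   a law mp_law z for each starting point z. *)
Record markovProcess {R : realType} (E : polishType R) := MarkovProcess {
  mp_display : measure_display;
  mp_space : measurableType mp_display;
  mp_law : E -> probability mp_space R;
  mp_path : R -> mp_space -> E;
  mp_process : process mp_path;
  mp_start : forall z, {ae mp_law z, forall w, mp_path 0 w = z};
  mp_kernel : forall t f, 0 <= t -> Bb E f ->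
    measurable_fun setT
      ((fun z => \int[mp_law z]_w f (mp_path t w)) : borel E -> R);
  mp_markov : forall z s t f, 0 <= s -> 0 <= t -> Bb E f ->
    is_cond_exp (mp_law z) (filtration_of mp_path s)
      (fun w => f (mp_path (s + t) w))
      (fun w => \int[mp_law (mp_path s w)]_w' f (mp_path t w'))
}.

Definition mp_expectation {R : realType} {E : polishType R}
    (Z : markovProcess E) (z : E) (U : mp_space Z -> R) : R :=
  \int[mp_law Z z]_w U w.
Arguments mp_expectation {R E} Z z U.

Definition mp_semigroup {R : realType} {E : polishType R}
    (Z : markovProcess E) (t : R) (f : E -> R) (z : E) : R :=
  mp_expectation Z z (fun w => f (mp_path t w)).

(* E_z [g(Z_t) exp(int_0^t beta(Z_s) ds)] *)
Definition feynman_kac {R : realType} {E : polishType R}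
    (Z : markovProcess E) (beta g : E -> R) (t : R) (z : E) : R :=
  mp_expectation Z z (fun w =>
    g (mp_path t w) *
    expR (\int[lebesgue_measure]_(s in `[0, t]) beta (mp_path s w))).

Section skorokhod.
Context {R : realType} {E : polishType R}.
Implicit Types (w v : R -> E).

Definition cadlag w :=
  (forall t, 0 <= t -> w s @[s --> t^'+] --> w t) /\
  (forall t, 0 < t -> cvg (w s @[s --> t^'-])).

Definition time_change (l : R -> R) :=
  (forall s t, 0 <= s -> s < t -> l s < l t) /\
  l @` [set t | 0 <= t] = [set t | 0 <= t].

(* As T and e vary, the sets of cadlag paths v with skorokhod_close w T e v
   form a neighbourhood base at w of the Skorokhod J1 topology on the space of
   cadlag paths [0, oo) -> E: v_n --> w iff for all T there are time changes l_n
   with sup_(t <= T) |l_n(t) - t| --> 0 and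
   sup_(t <= T) dist(v_n(t), w(l_n(t))) --> 0
   (Ethier and Kurtz, Markov Processes, Proposition 3.5.3). *)
Definition skorokhod_close w (T e : R) v :=
  exists2 l : R -> R, time_change l &
    forall t, 0 <= t <= T ->
      `|l t - t| <= e /\ mdist (v t) (w (l t)) <= e.

Definition skorokhod_continuous (Phi : (R -> E) -> R) :=
  forall w, cadlag w -> forall e : R, 0 < e ->
    exists T delta : R, 0 < delta /\
      forall v, cadlag v -> skorokhod_close w T delta v ->
        `|Phi v - Phi w| <= e.

(* Weak convergence on Skorokhod space of the laws of processes with cadlag
   paths, for each common starting point.  The Borel sigma-algebra of Skorokhod
   space is generated by the evaluations, so the integrands are measurable. *)
Definition cvg_in_distribution (Z_ : nat -> markovProcess E)
    (Z : markovProcess E) :=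
  [/\ (forall n (o : mp_space (Z_ n)), cadlag (fun t => mp_path t o)),
      (forall o : mp_space Z, cadlag (fun t => mp_path t o)) &
      forall (z : E) (Phi : (R -> E) -> R),
        skorokhod_continuous Phi ->
        (exists M : R, forall w, cadlag w -> `|Phi w| <= M) ->
        mp_expectation (Z_ n) z (fun o => Phi (fun t => mp_path t o))
          @[n --> \oo] -->
        mp_expectation Z z (fun o => Phi (fun t => mp_path t o))].

End skorokhod.

Definition dual_with_potential {R : realType} {EX EY : polishType R}
    (H : EX * EY -> R) (beta : EY -> R)
    (X : markovProcess EX) (Y : markovProcess EY) :=
  forall x y t, 0 <= t ->
    mp_expectation X x (fun w => H (mp_path t w, y)) =
    feynman_kac Y beta (fun y' => H (x, y')) t y.

(* Main.v *)
Require Import Defs.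
From HB Require Import structures.
From mathcomp Require Import all_boot all_order all_algebra.
From mathcomp Require Import all_classical all_reals all_analysis.
From mathcomp Require Import measurable_realfun.
From mathcomp Require Import ring lra.

Set Implicit Arguments.
Unset Strict Implicit.
Unset Printing Implicit Defensive.

Import Order.TTheory GRing.Theory Num.Theory.
Import numFieldNormedType.Exports.

Local Open Scope classical_set_scope.
Local Open Scope ring_scope.

(** Let A be the span of the functions H(., y).  For f = sum_i c_i H(., y_i) in
    A, the value P_t f (x) is the sum over i of
      c_i E_(y_i) [H(x, Y_t) exp(int_0^t beta(Y_s) ds)].
    With Y^n in place of Y, duality turns this sum into E_x [f(X^n_t)], which
    lies between any two constants that bound f.  Hence it suffices to let n
    tend to infinity: then a <= f <= b implies a <= P_t f <= b, which contains
    both positivity and P_t 1 = 1.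

    Evaluation at a fixed time is not continuous in the Skorokhod topology, so
    the limit is taken on time averages.  A right-continuous path has countably
    many discontinuities, and Skorokhod convergence implies convergence at all
    other times; so the integral over s in [t, r] of
      H(x, w s) exp(int_0^s beta(w u) du)
    is a Skorokhod continuous function of the path w
    ([skorokhod_continuous_path_weight]).  By Fubini's theorem its expectation
    is the integral over [t, r] of the Feynman-Kac expectations
    ([mean_integral_weight]), to which duality applies; and those are
    right-continuous in time, so letting r decrease to t recovers the value at
    t ([feynman_kac_span_le]).

    For the kernels, A is an algebra that contains 1, and it separates points
    because it is convergence determining.  By the Stone-Weierstrass theorem it
    is uniformly dense in C(E_X), so each functional f |-> P_t f (x) extends to
    a positive functional on C(E_X) ([positive_functional_extension]), which
    the Riesz theorem represents by a probability measure mu_t(x, .)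
    ([riesz_representation]).  For U open, x |-> mu_t(x, U) is a pointwise
    limit of functions P_t a_n with a_n in A, hence measurable; the pi-lambda
    theorem extends this to Borel sets ([kernel_representation]). *)

(** * Bounded functions and their integrals *)

Section borel_functions.
Context {R : realType}.

Lemma open_borel (E : polishType R) (U : set E) :
  open U -> measurable (U : set (borel E)).
Proof. exact: sub_sigma_algebra. Qed.

Lemma continuous_borel_measurable (E : polishType R) (f : E -> R) :
  continuous f -> measurable_fun setT (f : borel E -> R).
Proof.
move=> /continuousP cf.
apply: (measurability _ (RGenOpens.measurableE R)).
move=> _ [B [a [b ->] <-]]; rewrite setTI.
by apply: sub_sigma_algebra; apply: cf; exact: interval_open.
Qed.

Lemma le_bounded_fun (T : Type) (f : T -> R) (M : R) :
  (forall x, `|f x| <= M) -> bounded_fun f.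
Proof.
move=> fM; exists M; split; first exact: num_real.
by move=> N MN x _ /=; rewrite (le_trans (fM x))// ltW.
Qed.

Lemma bounded_fun_le (T : Type) (f : T -> R) :
  bounded_fun f -> exists M, 0 < M /\ forall x, `|f x| <= M.
Proof.
move=> [M [_ fM]]; exists (`|M| + 1); split; first by rewrite ltr_pwDr.
move=> x; apply: (fM (`|M| + 1)) => //.
by rewrite (le_lt_trans (ler_norm M))// ltrDl.
Qed.

Context d (T : measurableType d) (mu : {measure set T -> \bar R}) (D : set T).
Hypothesis mD : measurable D.

Lemma le_bounded_integrable (f : T -> R) (M : R) : (mu D < +oo)%E ->
  measurable_fun D f -> (forall x, D x -> `|f x| <= M) ->
  mu.-integrable D (EFin \o f).
Proof.
move=> muD mf fM; apply: measurable_bounded_integrable => //.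
exists M; split; first exact: num_real.
by move=> N MN x Dx /=; rewrite (le_trans (fM x Dx))// ltW.
Qed.

Lemma integrable_sum_EFin (I : Type) (s : seq I) (f : I -> T -> R) :
  (forall i, mu.-integrable D (EFin \o f i)) ->
  mu.-integrable D (EFin \o (fun x => \sum_(i <- s) f i x)).
Proof.
move=> fi; rewrite (_ : _ \o _ = fun x => (\sum_(i <- s) (f i x)%:E)%E).
  exact: (integrable_sum mD s (P := xpredT) (h := fun i => EFin \o f i)).
by apply/funext => x /=; rewrite sumEFin.
Qed.

Lemma Rintegral_sum (I : Type) (s : seq I) (f : I -> T -> R) :
  (forall i, mu.-integrable D (EFin \o f i)) ->
  \int[mu]_(x in D) (\sum_(i <- s) f i x) =
  \sum_(i <- s) \int[mu]_(x in D) f i x.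
Proof.
move=> fi; elim: s => [|i s IH].
  rewrite big_nil; under eq_Rintegral do rewrite big_nil.
  by rewrite Rintegral_cst// mul0r.
rewrite big_cons -IH; under eq_Rintegral do rewrite big_cons.
by apply: RintegralD => //; exact: integrable_sum_EFin.
Qed.

Lemma Rintegral_affine (f : T -> R) (a b : R) : (mu D < +oo)%E ->
  mu.-integrable D (EFin \o f) ->
  \int[mu]_(x in D) (a * f x + b) =
  a * \int[mu]_(x in D) f x + b * fine (mu D).
Proof.
move=> muD fi; rewrite RintegralD//.
- by rewrite RintegralZl// Rintegral_cst.
- by have := integrableZl mD a fi.
- by apply: (@le_bounded_integrable _ `|b|).
Qed.

Lemma norm_Rintegral_le (f : T -> R) (M : R) : (mu D < +oo)%E ->
  measurable_fun D f -> (forall x, D x -> `|f x| <= M) ->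
  `|\int[mu]_(x in D) f x| <= M * fine (mu D).
Proof.
move=> muD mf fM; have fi := le_bounded_integrable muD mf fM.
apply: le_trans (le_normr_Rintegral mD fi) _.
rewrite -Rintegral_cst//; apply: le_Rintegral => //.
- exact: integrable_norm fi.
- by apply: (@le_bounded_integrable _ `|M|).
Qed.

Lemma bounded_Rintegral_cvg (f_ : nat -> T -> R) (f : T -> R) (M : R) :
  (mu D < +oo)%E -> (forall n, measurable_fun D (f_ n)) ->
  measurable_fun D f -> (forall n x, D x -> `|f_ n x| <= M) ->
  {ae mu, forall x, D x -> f_ n x @[n --> \oo] --> f x} ->
  \int[mu]_(x in D) f_ n x @[n --> \oo] --> \int[mu]_(x in D) f x.
Proof.
move=> muD mf_ mf fM f_f; apply: fine_cvg.
have [|||||fi _] := @dominated_convergence _ _ _ mu D mD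
  (fun n => EFin \o f_ n) (EFin \o f) (fun=> M%:E).
- by move=> n; exact/measurable_EFinP.
- exact/measurable_EFinP.
- by apply: filterS f_f => x f_f Dx; apply: cvg_EFin; [exact: nearW|exact: f_f].
- by apply: (@le_bounded_integrable (fun=> M) `|M|).
- by apply: aeW => x n Dx; rewrite lee_fin fM.
by rewrite fineK//; exact: integrable_fin_num.
Qed.

End borel_functions.

Lemma probability_bounded_integrable (R : realType) d (T : measurableType d)
    (P : probability T R) (f : T -> R) (M : R) :
  measurable_fun setT f -> (forall x, `|f x| <= M) ->
  P.-integrable setT (EFin \o f).
Proof.
move=> mf fM; apply: (le_bounded_integrable measurableT _ mf) => //.
by apply: le_lt_trans (probability_le1 P measurableT) _; rewrite ltry.
Qed.

Lemma probability_Rintegral_affine (R : realType) d (T : measurableType d)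
    (P : probability T R) (f : T -> R) (a b : R) :
  P.-integrable setT (EFin \o f) ->
  \int[P]_x (a * f x + b) = a * \int[P]_x f x + b.
Proof.
move=> fi; rewrite Rintegral_affine//.
  rewrite [X in fine X](_ : _ = 1%E) ?mulr1//; exact: probability_setT.
by apply: le_lt_trans (probability_le1 P measurableT) _; rewrite ltry.
Qed.

(** * Families of continuous functions on a compact space *)

Section compact_families.
Context {R : realType} {T : ptopologicalType}.
Implicit Types (P : set (T -> R)) (f g h : T -> R).

Lemma open_lt_continuous f g : continuous f -> continuous g ->
  open [set x | f x < g x].
Proof.
move=> cf cg.
rewrite (_ : mkset _ = (fun x => f x - g x) @^-1` [set r | r < 0]).
  apply: open_comp; last exact: open_lt.
  by move=> x _; apply: cvgB; [exact: cf|exact: cg].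
by apply/seteqP; split => x /=; rewrite subr_lt0.
Qed.

(** Dini's theorem for directed families: finitely many of the open sets
    [h < f] cover the space, and some member of P lies below the finitely many
    functions h that occur. *)
Lemma compact_directed_lt P f : compact [set: T] ->
  (forall h, P h -> continuous h) -> continuous f ->
  (forall g h, P g -> P h ->
    exists k, P k /\ forall x, k x <= g x /\ k x <= h x) ->
  (forall x, exists h, P h /\ h x < f x) ->
  exists h, P h /\ forall x, h x < f x.
Proof.
rewrite compact_cover => cT cP cf dP /choice[h_ hP].
have [||D _ covD] := cT T [set: T] (fun y => [set x | h_ y x < f x]).
- by move=> y _; apply: open_lt_continuous => //; apply: cP; exact: (hP y).1.
- by move=> x _; exists x => //; exact: (hP x).2.
have [k [Pk kle]] : exists k, P k /\
    forall y, y \in finmap.enum_fset D -> forall x, k x <= h_ y x.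
  elim: (finmap.enum_fset D) => [|y s [k [Pk kle]]].
    by exists (h_ point); split; [exact: (hP point).1|].
  have [k' [Pk' k'le]] := dP _ _ Pk (hP y).1.
  exists k'; split => // z; rewrite inE => /predU1P[->|zs] x.
    exact: (k'le x).2.
  exact: le_trans (k'le x).1 (kle _ zs x).
exists k; split => // x; have [y /= yD] := covD x Logic.I.
by apply: le_lt_trans; exact: kle.
Qed.

(** Compactness enters through the directed family of the constants -n, which
    contains an element below -|f|. *)
Lemma continuous_compact_bounded f : compact [set: T] -> continuous f ->
  exists M, 0 < M /\ forall x, `|f x| <= M.
Proof.
move=> cT cf.
have [||||] := @compact_directed_lt [set g | exists n : nat, g = fun=> - n%:R]
  (fun x => - `|f x|) cT.
- by move=> _ [n ->] x; exact: cvg_cst.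
- move=> x; apply: cvgN; apply: cvg_norm; exact: cf.
- move=> _ _ [m ->] [n ->]; exists (fun=> - (maxn m n)%:R); split.
    by exists (maxn m n).
  by move=> x; rewrite !lerN2 !ler_nat leq_maxl leq_maxr.
- move=> x; exists (fun=> - (Num.truncn `|f x|).+1%:R); split; first by eexists.
  by rewrite ltrN2 truncnS_gt.
move=> _ [[n ->] nf]; exists n.+1%:R; split => // x.
have := nf x; rewrite ltrN2 => /ltW/le_trans; apply.
by rewrite ler_nat.
Qed.

End compact_families.

(** * Vector spaces of functions and linear functionals *)

Section linear_functionals.
Context {R : realType} {E : polishType R}.
Implicit Types (A : set (E -> R)) (L : (E -> R) -> R^o) (f g : E -> R).

Lemma vector_spaceZ A (a : R) f : vector_space A -> A f -> A (fun x => a * f x).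
Proof.
move=> [A0 AD] Af; have := AD a _ _ Af A0.
by under eq_fun do rewrite addr0.
Qed.

Lemma vector_spaceD A f g : vector_space A -> A f -> A g ->
  A (fun x => f x + g x).
Proof.
move=> [A0 AD] Af Ag; have := AD 1 _ _ Af Ag.
by under eq_fun do rewrite mul1r.
Qed.

Lemma vector_spaceB A f g : vector_space A -> A f -> A g ->
  A (fun x => f x - g x).
Proof.
move=> [A0 AD] Af Ag; have := AD (-1) _ _ Ag Af.
by under eq_fun do rewrite mulN1r addrC.
Qed.

Lemma linear_on0 A L : vector_space A -> linear_on A L -> L (fun=> 0) = 0.
Proof.
move=> vA lL; have := lL 1 _ _ vA.1 vA.1.
under eq_fun do rewrite mulr0 addr0.
by rewrite scale1r => /esym/eqP; rewrite -subr_eq0 addrK => /eqP.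
Qed.

Lemma linear_onZ A L (a : R) f : vector_space A -> linear_on A L -> A f ->
  L (fun x => a * f x) = a * L f.
Proof.
move=> vA lL Af; rewrite -[RHS]addr0 -[in RHS](linear_on0 vA lL).
have := lL a _ _ Af vA.1.
by under eq_fun do rewrite addr0.
Qed.

Lemma linear_on_sum A L n (c : 'I_n -> R)
    (g : 'I_n -> E -> R) : vector_space A -> linear_on A L ->
  (forall i, A (g i)) ->
  A (fun x => \sum_(i < n) c i * g i x) /\
  L (fun x => \sum_(i < n) c i * g i x) = \sum_(i < n) c i * L (g i).
Proof.
move=> vA lL; elim: n c g => [|n IH] c g Ag.
  rewrite big_ord0; under eq_fun do rewrite big_ord0; split; first exact: vA.1.
  exact: linear_on0 vA lL.
have [AS LS] := IH (fun i => c (lift ord0 i)) (fun i => g (lift ord0 i))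
  (fun i => Ag _).
rewrite big_ord_recl; under eq_fun do rewrite big_ord_recl.
by split; [exact: vA.2|rewrite lL// LS].
Qed.

Lemma linear_on_monotone A L f g : vector_space A -> linear_on A L ->
  positive_functional A L -> A f -> A g -> (forall x, f x <= g x) -> L f <= L g.
Proof.
move=> vA lL pL Af Ag fg; rewrite -subr_ge0.
have -> : L g - L f = L (fun x => -1 * f x + g x).
  by rewrite lL// addrC; congr (_ + _); rewrite /GRing.scale/= mulN1r.
by apply: pL => [|x]; [exact: vA.2|rewrite mulN1r addrC subr_ge0].
Qed.

Lemma linear_on_cstD A L f (e : R) : vector_space A -> linear_on A L ->
  A (fun=> 1) -> L (fun=> 1) = 1 -> A f ->
  A (fun x => f x + e) /\ L (fun x => f x + e) = L f + e.
Proof.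
move=> vA lL A1 L1 Af.
have -> : (fun x => f x + e) = (fun x => e * 1 + f x).
  by apply/funext => x; rewrite mulr1 addrC.
split; first exact: vA.2.
by rewrite lL// L1 addrC; congr (_ + _); rewrite /GRing.scale/= mulr1.
Qed.

Lemma sub_linear_span A : A `<=` linear_span A.
Proof.
move=> f Af; exists 1%N, (fun=> 1), (fun=> f); split => //.
by apply/funext => x; rewrite big_ord1 mul1r.
Qed.

Lemma sub_bp_closure A : A `<=` bp_closure A.
Proof. by move=> f Af D [AD _ _]; exact: AD. Qed.

Lemma continuous_vector_space : vector_space [set f : E -> R | continuous f].
Proof.
split; first exact: cst_continuous.
move=> a f g cf cg x; apply: cvgD; last exact: cg.
by apply: cvgM; [exact: cvg_cst|exact: cf].
Qed.

End linear_functionals.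

(** * The Stone-Weierstrass theorem *)

Section stone_weierstrass.
Context {R : realType} {E : polishType R}.
Implicit Types (A : set (E -> R)) (f g h : E -> R).

Definition uniform_closure A : set (E -> R) :=
  [set f | forall e : R, 0 < e -> exists2 g, A g & forall x, `|f x - g x| <= e].

Lemma sub_uniform_closure A : A `<=` uniform_closure A.
Proof.
by move=> f Af e e0; exists f => // x; rewrite subrr normr0 ltW.
Qed.

Lemma uniform_closure_idem A :
  uniform_closure (uniform_closure A) `<=` uniform_closure A.
Proof.
move=> f fA e e0; have e20 : 0 < e / 2 by rewrite divr_gt0.
have [g gA fg] := fA _ e20; have [h Ah gh] := gA _ e20.
exists h => // x; rewrite [e]splitr.
have -> : f x - h x = (f x - g x) + (g x - h x) by rewrite addrA subrK.
by rewrite (le_trans (ler_normD _ _))// lerD.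
Qed.

Lemma uniform_closure_vector A : vector_space A ->
  vector_space (uniform_closure A).
Proof.
move=> vA; split; first by apply: sub_uniform_closure; exact: vA.1.
move=> a f g fA gA e e0.
have d0 : 0 < e / 2 / (`|a| + 1) by rewrite !divr_gt0// ltr_pwDr.
have [f' Af' ff'] := fA _ d0.
have [g' Ag' gg'] := gA _ (divr_gt0 e0 (ltr0Sn R 1)).
exists (fun x => a * f' x + g' x); first exact: vA.2.
move=> x; rewrite (_ : _ - _ = a * (f x - f' x) + (g x - g' x)); last by ring.
rewrite (le_trans (ler_normD _ _))// [e]splitr lerD// normrM.
apply: (@le_trans _ _ ((`|a| + 1) * (e / 2 / (`|a| + 1)))).
  by apply: ler_pM => //; rewrite lerDl.
by rewrite mulrC divfK// gt_eqF// ltr_pwDr.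
Qed.

(** A sequence of polynomials in u that increases to |u| on [-1, 1]. *)
Fixpoint abs_approx (u : R) (n : nat) : R :=
  if n is n'.+1 then
    abs_approx u n' + (u ^+ 2 - abs_approx u n' ^+ 2) / 2
  else 0.

(** A step multiplies the error |u| - p by 1 - (|u| + p) / 2 <= 1 - |u| / 2.
    The factor 2 + n |u| compensates for this decay, which makes the bound
    inductive, and keeps it uniform in u near 0. *)
Lemma abs_approx_bound (u : R) n : `|u| <= 1 ->
  0 <= abs_approx u n <= `|u| /\
  (`|u| - abs_approx u n) * (2 + n%:R * `|u|) <= 2 * `|u|.
Proof.
move=> u1; have s0 := normr_ge0 u.
elim: n => [|n [/andP[p0 ps] IH]] /=.
  by rewrite lexx s0 subr0 mul0r addr0 mulrC.
rewrite -(real_normK (num_real u)); move: p0 ps IH.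
set s := `|u| in u1 s0 *; set p := abs_approx u n => p0 ps IH.
have n0 : 0 <= n%:R :> R by [].
have -> : s - (p + (s ^+ 2 - p ^+ 2) / 2) = (s - p) * (1 - (s + p) / 2) by field.
split; [apply/andP; split; nra|].
apply: le_trans IH; rewrite -mulrA ler_wpM2l ?subr_ge0//.
rewrite -(natr1 n); have := mulr_ge0 n0 s0; have := mulr_ge0 n0 p0.
have := mulr_ge0 n0 (mulr_ge0 s0 s0); have := mulr_ge0 n0 (mulr_ge0 s0 p0).
nra.
Qed.

Lemma abs_approx_cvg (u : R) n : `|u| <= 1 ->
  `| `|u| - abs_approx u n.+1| <= 2 / n.+1%:R.
Proof.
move=> u1; have [/andP[p0 ps]] := abs_approx_bound n.+1 u1.
have := normr_ge0 u; move: p0 ps; set p := abs_approx _ _; set s := `|u|.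
move=> p0 ps s0 H; rewrite ger0_norm ?subr_ge0// ler_pdivlMr//.
have [s_eq0|s_neq0] := eqVneq s 0.
  move: ps; rewrite s_eq0 => ps.
  have -> : p = 0 by apply/eqP; rewrite eq_le ps p0.
  by rewrite subr0 mul0r.
have sgt0 : 0 < s by rewrite lt_neqAle eq_sym s_neq0.
rewrite -(ler_pM2r sgt0); apply: le_trans H; rewrite mulrDr mulrA.
by rewrite lerDr mulr_ge0// subr_ge0.
Qed.

Lemma algebra_abs_approx A f n : algebra_on A -> A f ->
  A (fun x => abs_approx (f x) n).
Proof.
move=> [vA mA] Af; elim: n => [|n IH] /=; first exact: vA.1.
have -> : (fun x => abs_approx (f x) n +
    (f x ^+ 2 - abs_approx (f x) n ^+ 2) / 2) = (fun x => abs_approx (f x) n +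
    2^-1 * (f x * f x - abs_approx (f x) n * abs_approx (f x) n)).
  by apply/funext => x; rewrite !expr2 [X in _ + X]mulrC.
apply: vector_spaceD => //; apply: vector_spaceZ => //.
by apply: vector_spaceB => //; apply: mA.
Qed.

(** Taking absolute values is 1-Lipschitz for the supremum norm, so only |g| for
    g in A has to be approximated; there the polynomials [abs_approx] of g / M
    belong to A. *)
Lemma uniform_closure_norm A f : algebra_on A ->
  (forall g, A g -> exists M, 0 < M /\ forall x, `|g x| <= M) ->
  uniform_closure A f -> uniform_closure A (fun x => `|f x|).
Proof.
move=> aA bA fA; apply: uniform_closure_idem => e e0.
have [g Ag fg] := fA e e0; exists (fun x => `|g x|); last first.
  by move=> x; apply: le_trans (fg x); exact: ler_dist_dist.
move=> d d0; have [M [M0 gM]] := bA _ Ag.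
have Mdn0 : 0 <= 2 * M / d by rewrite divr_ge0// ?mulr_ge0// ltW.
pose n := Num.truncn (2 * M / d).
exists (fun x => M * abs_approx (M^-1 * g x) n.+1).
  apply: (vector_spaceZ _ aA.1); apply: (algebra_abs_approx _ aA).
  exact: (vector_spaceZ _ aA.1).
move=> x; have u1 : `|M^-1 * g x| <= 1.
  by rewrite normrM gtr0_norm ?invr_gt0// mulrC ler_pdivrMr// mul1r.
have -> : `|g x| = M * `|M^-1 * g x|.
  by rewrite normrM gtr0_norm ?invr_gt0// mulVKf// gt_eqF.
rewrite -mulrBr normrM gtr0_norm//.
apply: (@le_trans _ _ (M * (2 / n.+1%:R))).
  by rewrite ler_wpM2l ?abs_approx_cvg// ltW.
rewrite mulrA ler_pdivrMr// -ler_pdivrMl// mulrC (mulrC M).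
by apply/ltW; rewrite truncnS_gt.
Qed.

Lemma uniform_closure_min A f g : algebra_on A ->
  (forall g, A g -> exists M, 0 < M /\ forall x, `|g x| <= M) ->
  uniform_closure A f -> uniform_closure A g ->
  uniform_closure A (fun x => Num.min (f x) (g x)).
Proof.
move=> aA bA fA gA; have vA := uniform_closure_vector aA.1.
have -> : (fun x => Num.min (f x) (g x)) =
    (fun x => 2^-1 * ((f x + g x) - `|f x - g x|)).
  apply/funext => x; rewrite minEle; case: ifPn => [fg|].
    by rewrite ler0_norm ?subr_le0//; field.
  by rewrite -ltNge => /ltW gf; rewrite ger0_norm ?subr_ge0//; field.
apply: (vector_spaceZ _ vA); apply: (vector_spaceB vA).
  exact: (vector_spaceD vA).
by apply: uniform_closure_norm => //; exact: (vector_spaceB vA).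
Qed.

(** The closure B of A is a lattice, and separation of points lets members of B
    take the values of f at two prescribed points.  For fixed x, the members of
    B that agree with f at x form a family directed downwards, so one of them
    lies below f + e.  The members of B below f + e are directed upwards, and
    at each point one of them equals f; so one of them lies above f - e. *)
Lemma stone_weierstrass A : compact [set: E] -> algebra_on A -> A (fun=> 1) ->
  (forall f, A f -> continuous f) ->
  (forall x y, x != y -> exists2 f, A f & f x != f y) ->
  forall f, continuous f -> uniform_closure A f.
Proof.
move=> cE aA A1 cA sepA f cf; have vA := aA.1.
have bA g : A g -> exists M, 0 < M /\ forall x, `|g x| <= M.
  by move=> /cA; exact: continuous_compact_bounded.
pose B := [set g | uniform_closure A g /\ continuous g].
have vB : vector_space B.
  split.
    by split; [exact: (uniform_closure_vector vA).1|exact: cst_continuous].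
  move=> a g h [gA cg] [hA ch]; split.
    exact: (uniform_closure_vector vA).2.
  by move=> x; apply: cvgD; [apply: cvgM; [exact: cvg_cst|exact: cg]|exact: ch].
have minB g h : B g -> B h -> B (fun x => Num.min (g x) (h x)).
  move=> [gA cg] [hA ch]; split; first exact: uniform_closure_min.
  exact: (min_fun_continuous cg ch).
have interp x y : exists g, [/\ B g, g x = f x & g y = f y].
  have [<-|xy] := eqVneq x y.
    exists (fun=> f x); split => //; split; last exact: cst_continuous.
    apply: sub_uniform_closure; rewrite (_ : (fun=> _) = (fun=> f x * 1)).
      exact: vector_spaceZ.
    by apply/funext => z; rewrite mulr1.
  have [a Aa axy] := sepA _ _ xy.
  pose c := (f y - f x) / (a y - a x).
  exists (fun z => c * a z + (f x - c * a x) * 1); split.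
  - have Ac : A (fun z => c * a z + (f x - c * a x) * 1).
      by apply: vector_spaceD => //; exact: vector_spaceZ.
    by split; [exact: sub_uniform_closure|exact: cA].
  - by rewrite mulr1 addrC subrK.
  - by rewrite /c; field; rewrite subr_eq0 eq_sym.
suff H e : 0 < e -> exists g, B g /\ forall x, `|f x - g x| < e.
  apply: uniform_closure_idem => e e0; have [g [[gA _] fg]] := H _ e0.
  by exists g => // x; exact/ltW/fg.
move=> e0.
have cD (g : E -> R) d : continuous g -> continuous (fun x => g x + d).
  by move=> cg x; apply: cvgD; [exact: cg|exact: cvg_cst].
have cN (g : E -> R) : continuous g -> continuous (fun x => - g x).
  by move=> cg x; apply: cvgN; exact: cg.
have below x : exists g, [/\ B g, g x = f x & forall y, g y < f y + e].
  have [||||g [[Bg gx] gf]] := @compact_directed_lt _ _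
    [set g | B g /\ g x = f x] (fun y => f y + e) cE.
  - by move=> h [[]].
  - exact: cD.
  - move=> g h [Bg gx] [Bh hx]; exists (fun y => Num.min (g y) (h y)); split.
      by split; [exact: minB|rewrite gx hx minxx].
    by move=> y; rewrite !ge_min !lexx orbT.
  - move=> y; have [g [Bg gx gy]] := interp x y.
    by exists g; split => //; rewrite gy ltrDl.
  by exists g.
(* Passing to opposites turns the upward directed family into a downward
   directed one. *)
have [||||h [[g [Bg gf ->]] gtf]] := @compact_directed_lt _ _
    [set h | exists g, [/\ B g, (forall y, g y < f y + e) & h = fun y => - g y]]
    (fun y => - f y + e) cE.
- by move=> _ [g [[_ cg] _ ->]]; exact: cN.
- by apply: cD; exact: cN.
- move=> _ _ [g [Bg gf ->]] [h [Bh hf ->]].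
  pose k y := - Num.min (- g y) (- h y).
  have Bk : B k.
    have BN u : B u -> B (fun y => - u y).
      by move=> /(vector_spaceZ (-1) vB); under eq_fun do rewrite mulN1r.
    by apply: (BN); apply: minB; exact: BN.
  exists (fun y => - k y); split; last first.
    by move=> y; rewrite /k opprK !ge_min !lexx orbT.
  exists k; split => // y; rewrite /k minEle.
  by case: ifP => _; rewrite opprK.
- move=> x; have [g [Bg gx gf]] := below x.
  exists (fun y => - g y); split; first by exists g.
  by rewrite gx ltrDl.
exists g; split => // x; rewrite ltr_norml; have := gf x; have := gtf x.
by move=> ? ?; apply/andP; split; lra.
Qed.

End stone_weierstrass.

(** * Extension of positive functionals to continuous functions *)

Section functional_extension.
Context {R : realType} {E : polishType R}.
Implicit Types (A : set (E -> R)) (L : (E -> R) -> R^o) (f g : E -> R).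

Lemma eq_of_le_mul_eps (K x y : R) : 0 < K ->
  (forall e, 0 < e -> `|x - y| <= K * e) -> x = y.
Proof.
move=> K0 H; apply/eqP; rewrite -subr_eq0 -normr_eq0 eq_le normr_ge0 andbT.
apply/ler_addgt0Pl => e e0; rewrite addr0.
have := H (e / K) (divr_gt0 e0 K0).
by rewrite mulrC divfK// gt_eqF.
Qed.

Definition upper_extension A L f : R := inf [set L g | g in
  [set g | A g /\ forall x, f x <= g x]].

(** By density, this estimate alone determines the extension, and yields its
    linearity and positivity. *)
Lemma upper_extension_approx A L f g (e : R) : vector_space A ->
  linear_on A L -> positive_functional A L -> A (fun=> 1) -> L (fun=> 1) = 1 ->
  A g -> (forall x, `|f x - g x| <= e) -> `|upper_extension A L f - L g| <= e.
Proof.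
move=> vA lL pL A1 L1 Ag fg.
have [Age Lge] := linear_on_cstD e vA lL A1 L1 Ag.
have [AgN LgN] := linear_on_cstD (- e) vA lL A1 L1 Ag.
pose S := [set L g | g in [set g | A g /\ forall x, f x <= g x]].
have lb : lbound S (L g - e).
  move=> _ [h [Ah fh] <-]; rewrite -LgN.
  apply: (linear_on_monotone vA lL pL) => //.
  move=> x; apply: le_trans (fh x).
  by have := fg x; rewrite ler_norml => /andP[? ?]; lra.
have inS : S (L g + e).
  exists (fun x => g x + e) => //; split => // x.
  by have := fg x; rewrite ler_norml => /andP[? ?]; lra.
rewrite ler_distl; apply/andP; split.
  by apply: lb_le_inf => //; exists (L g + e).
by apply: ge_inf => //; exists (L g - e).
Qed.

Lemma positive_functional_extension A L : vector_space A ->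
  linear_on A L -> positive_functional A L -> A (fun=> 1) -> L (fun=> 1) = 1 ->
  (forall f, continuous f -> uniform_closure A f) ->
  exists L' : (E -> R) -> R^o,
    [/\ linear_on [set f | continuous f] L',
        positive_functional [set f | continuous f] L' &
        forall f, A f -> L' f = L f].
Proof.
move=> vA lL pL A1 L1 dA; exists (upper_extension A L).
have app := upper_extension_approx vA lL pL A1 L1.
split.
- move=> a f g cf cg; apply: (@eq_of_le_mul_eps (2 * (`|a| + 1))).
    by rewrite mulr_gt0// ltr_pwDr.
  move=> e e0; have [f' Af' ff'] := dA _ cf _ e0.
  have [g' Ag' gg'] := dA _ cg _ e0.
  have h1 := app _ _ _ Af' ff'; have h2 := app _ _ _ Ag' gg'.
  have h3 : `|upper_extension A L (fun x => a * f x + g x) -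
              L (fun x => a * f' x + g' x)| <= `|a| * e + e.
    apply: app; first exact: vA.2.
    move=> x.
    rewrite (_ : _ - _ = a * (f x - f' x) + (g x - g' x)); last by ring.
    by rewrite (le_trans (ler_normD _ _))// lerD// normrM ler_wpM2l.
  move: h3; rewrite lL// /GRing.scale/= => h3.
  set u := upper_extension _ _ _ in h3 *.
  set v := upper_extension _ _ f in h1 *; set w := upper_extension _ _ g in h2 *.
  have -> : u - (a * v + w) = (u - (a * L f' + L g')) +
     (a * (L f' - v) + (L g' - w)) by ring.
  have -> : 2 * (`|a| + 1) * e = (`|a| * e + e) + (`|a| * e + e) by ring.
  rewrite (le_trans (ler_normD _ _))// lerD//.
  rewrite (le_trans (ler_normD _ _))// lerD//; last by rewrite distrC.
  by rewrite normrM ler_wpM2l// distrC.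
- move=> f cf f0; apply/ler_addgt0Pl => e e0.
  have e20 : 0 < e / 2 by rewrite divr_gt0.
  have [f' Af' ff'] := dA _ cf _ e20.
  have [Ae Le] := linear_on_cstD (e / 2) vA lL A1 L1 Af'.
  have : 0 <= L (fun x => f' x + e / 2).
    apply: pL => // x; have := ff' x; have := f0 x.
    by rewrite ler_norml => ? /andP[? ?]; lra.
  rewrite Le; have := app _ _ _ Af' ff'; rewrite ler_norml => /andP[? ?] ?.
  by lra.
- move=> f Af; apply: (@eq_of_le_mul_eps 1) => // e e0; rewrite mul1r.
  by apply: app => // x; rewrite subrr normr0 ltW.
Qed.

End functional_extension.

(** * Indicators of open sets as increasing limits of continuous functions *)

Section open_indicators.
Context {R : realType} {E : polishType R}.
Implicit Types (U F : set E) (x y : E).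

Lemma continuous_of_dist (f : E -> R) :
  (forall x y, `|f x - f y| <= mdist x y) -> continuous f.
Proof.
move=> fd x; apply/cvgrPdist_lt => e e0; near=> y.
rewrite (le_lt_trans (fd x y))//.
have : ball x e y by near: y; exact: nbhsx_ballx.
by rewrite ballEmdist.
Unshelve. all: by end_near. Qed.

Definition set_dist F x : R := inf [set mdist x y | y in F].

Lemma set_dist_le F x y : F y -> set_dist F x <= mdist x y.
Proof.
move=> Fy; apply: ge_inf; last by exists y.
by exists 0 => _ [z _ <-]; exact: mdist_ge0.
Qed.

Lemma le_set_dist F x (r : R) : F !=set0 ->
  (forall y, F y -> r <= mdist x y) -> r <= set_dist F x.
Proof.
move=> [y Fy] rF; apply: lb_le_inf; first by exists (mdist x y); exists y.
by move=> _ [z Fz <-]; exact: rF.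
Qed.

Lemma set_dist_lip F x y : F !=set0 ->
  `|set_dist F x - set_dist F y| <= mdist x y.
Proof.
move=> F0; have H u v : set_dist F u - mdist u v <= set_dist F v.
  apply: le_set_dist => // z Fz; rewrite lerBlDl.
  exact: le_trans (set_dist_le u Fz) (metric_triangle _ _ _).
rewrite ler_distl; apply/andP; split; first by rewrite metric_sym; exact: H.
by rewrite -lerBlDr; exact: H.
Qed.

(** The functions are the truncations of n dist(., ~U) at 1.  The case U = E is
    apart, because the distance to the empty set, an infimum over the empty set,
    is 0. *)
Lemma open_indic_approx U : open U -> exists phi : nat -> E -> R,
  [/\ forall n, continuous (phi n),
      forall n x, 0 <= phi n x <= \1_U x,
      forall x, {homo phi^~ x : n m / (n <= m)%N >-> n <= m} &
      forall x, U x -> exists N, forall n, (N <= n)%N -> phi n x = 1].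
Proof.
move=> oU; have [UT|/set0P CU0] := eqVneq (~` U) set0.
  exists (fun _ _ => 1); split => //.
  - by move=> n; exact: cst_continuous.
  - move=> n x; rewrite ler01/= indicE mem_set//.
    by apply: contrapT => nUx; have : (~` U) x by []; rewrite UT.
  - by move=> x n m.
  - by move=> x Ux; exists 0%N.
exists (fun n x => Num.min 1 (n%:R * set_dist (~` U) x)).
have d0 x : 0 <= set_dist (~` U) x.
  by apply: le_set_dist => // y _; exact: mdist_ge0.
have cd : continuous (set_dist (~` U)).
  by apply: continuous_of_dist => u v; exact: set_dist_lip.
split.
- move=> n; apply: min_fun_continuous; first exact: cst_continuous.
  move=> x; apply: cvgM; first exact: cvg_cst.
  exact: cd.
- move=> n x; rewrite le_min ler01 mulr_ge0//= indicE.
  have [Ux|Ux] := boolP (x \in U); first by rewrite ge_min lexx.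
  rewrite ge_min; apply/orP; right.
  rewrite (_ : set_dist _ _ = 0) ?mulr0//; apply/eqP; rewrite eq_le d0 andbT.
  by rewrite -(mdistxx x); apply: set_dist_le; move: Ux; rewrite notin_setE.
- move=> x n m nm; rewrite le_min ge_min lexx/=.
  by rewrite ge_min; apply/orP; right; rewrite ler_wpM2r// ler_nat.
- move=> x Ux; have /nbhs_ballP[r/= r0 xrU] : nbhs x U by exact: open_nbhs_nbhs.
  exists (Num.truncn r^-1).+1 => n nr; apply/min_idPl.
  have rd : r <= set_dist (~` U) x.
    apply: le_set_dist => // y nUy; rewrite leNgt; apply/negP => xy; apply: nUy.
    by apply: xrU; rewrite ballEmdist.
  apply: (@le_trans _ _ (n%:R * r)); last by rewrite ler_wpM2l.
  rewrite -ler_pdivrMr// mul1r ltW// (lt_le_trans (truncnS_gt _))//.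
  by rewrite ler_nat.
Qed.

End open_indicators.

(** * The Riesz representation theorem on a compact metric space *)

Section caratheodory_borel.
Context {R : realType} {E : polishType R}.
Local Open Scope ereal_scope.

Lemma caratheodory_borel_probability (mu : {outer_measure set E -> \bar R}) :
  (forall U, open U -> mu.-caratheodory U) -> mu setT = 1 ->
  exists P : probability (borel E) R, forall A, P A = mu A.
Proof.
move=> muU mu1; pose m : set (borel E) -> \bar R := mu.
have sub (A : set (borel E)) : measurable A -> mu.-caratheodory A.
  apply: smallest_sub => //; split.
  - exact: caratheodory_measurable_set0.
  - by move=> B mB; rewrite setTD; exact: caratheodory_measurable_setC.
  - exact: caratheodory_measurable_bigcup.
have m_sigma : semi_sigma_additive m.
  move=> F mF tF mUF.
  apply: (@caratheodory_measure_sigma_additive _ _ mu F) => //.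
  - by move=> i; apply: sub; exact: mF.
  - exact: sub.
pose M : {measure set (borel E) -> \bar R} := HB.pack m
  (isMeasure.Build _ (borel E) R m (outer_measure0 mu) (outer_measure_ge0 mu)
     m_sigma).
pose P : probability (borel E) R := HB.pack (Measure.sort M)
  (Measure_isProbability.Build _ (borel E) R M mu1).
by exists P.
Qed.

End caratheodory_borel.

Lemma sum_threshold_le (R : realType) (n m : nat) (u : R) : 0 <= u ->
  \sum_(i < m) ((i%:R < n%:R * u)%R : nat)%:R <= n%:R * u + 1 :> R.
Proof.
move=> u0; elim: m => [|m IH]; first by rewrite big_ord0 addr_ge0// mulr_ge0.
rewrite big_ord_recr/=; case: ltP => mu; last by rewrite addr0.
apply: (@le_trans _ _ (m%:R + 1)); last by rewrite lerD2r ltW.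
rewrite lerD2r (@le_trans _ _ (\sum_(i < m) 1))//.
  by apply: ler_sum => i _; rewrite lern1 leq_b1.
by rewrite sumr_const card_ord.
Qed.

Section riesz.
Context {R : realType} {E : polishType R}.
Variable L : (E -> R) -> R^o.
Hypothesis cE : compact [set: E].
Hypothesis lL : linear_on [set f | continuous f] L.
Hypothesis pL : positive_functional [set f | continuous f] L.
Hypothesis L1 : L (fun=> 1) = 1.
Implicit Types (f g : E -> R) (U V A : set E).

Let vC := @continuous_vector_space R E.

Let L_mono f g : continuous f -> continuous g -> (forall x, f x <= g x) ->
  L f <= L g.
Proof. by move=> cf cg; exact: (linear_on_monotone vC lL pL). Qed.

Let L0 : L (fun=> 0) = 0. Proof. exact: linear_on0 vC lL. Qed.

Let LZ (a : R) f : continuous f -> L (fun x => a * f x) = a * L f.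
Proof. exact: (linear_onZ a vC lL). Qed.

Let LD f g : continuous f -> continuous g ->
  L (fun x => f x + g x) = L f + L g.
Proof.
move=> cf cg; rewrite -[in RHS](mul1r (L f)) -(lL _ cf cg).
by under eq_fun do rewrite -[X in X + _]mul1r.
Qed.

Let LDe f e : continuous f ->
  continuous (fun x => f x + e) /\ L (fun x => f x + e) = L f + e.
Proof.
by move=> cf; apply: (linear_on_cstD _ vC lL) => //; exact: cst_continuous.
Qed.

Let L_sum (g : nat -> E -> R) m : (forall i, continuous (g i)) ->
  continuous (fun x => \sum_(i < m) g i x) /\
  L (fun x => \sum_(i < m) g i x) = \sum_(i < m) L (g i).
Proof.
move=> cg; elim: m => [|m [cm Lm]].
  rewrite big_ord0; under eq_fun do rewrite big_ord0.
  by split; [exact: cst_continuous|exact: L0].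
rewrite big_ord_recr/=; under eq_fun do rewrite big_ord_recr/=.
rewrite LD// Lm; split => //.
by move=> x; apply: cvgD; [exact: cm|exact: cg].
Qed.

Local Open Scope ereal_scope.

(** The value that monotone convergence forces on a representing measure of L at
    an open set U. *)
Definition riesz_content U : \bar R :=
  ereal_sup [set (L f : R)%:E | f in
    [set f : E -> R | continuous f /\ forall x, (0 <= f x <= \1_U x)%R]].

Let content_ubound U f : continuous f -> (forall x, (0 <= f x <= \1_U x)%R) ->
  (L f : R)%:E <= riesz_content U.
Proof. by move=> cf fU; apply: ereal_sup_ubound; exists f. Qed.

Let content_ge0 U : 0 <= riesz_content U.
Proof.
rewrite -[0]/((0%R : R)%:E) -L0; apply: content_ubound; first exact: vC.1.
by move=> x; rewrite lexx/= indicE.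
Qed.

Let content_le U V : U `<=` V -> riesz_content U <= riesz_content V.
Proof.
move=> UV; apply: ge_ereal_sup => _ [f [cf fU] <-]; apply: content_ubound => //.
move=> x; have /andP[-> /=] := fU x; move/le_trans; apply.
rewrite !indicE ler_nat.
by case: (boolP (x \in U)) => // /set_mem/UV/mem_set ->.
Qed.

Let contentT : riesz_content setT = 1.
Proof.
apply/eqP; rewrite eq_le; apply/andP; split.
  apply: ge_ereal_sup => _ [f [cf fU] <-]; rewrite lee_fin -L1.
  apply: L_mono => //; first exact: cst_continuous.
  by move=> x; have := fU x; rewrite indicT => /andP[].
rewrite -[1]/((1%R : R)%:E) -L1.
apply: content_ubound; first exact: cst_continuous.
by move=> x; rewrite indicT ler01 lexx.
Qed.

Let content_fin U : riesz_content U \is a fin_num.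
Proof.
rewrite ge0_fin_numE//; apply: le_lt_trans (content_le (@subsetT _ U)) _.
by rewrite contentT ltry.
Qed.

(** Let phi_(i, m) increase with m to the indicator of F i.  For f below the
    indicator of the union, the functions f - sum_(i < m) phi_(i, m) decrease
    with m, and each point sees values below e; by compactness one of them is
    below e everywhere. *)
Let content_sigma_subadditive (F : nat -> set E) : (forall n, open (F n)) ->
  riesz_content (\bigcup_n F n) <= \sum_(n <oo) riesz_content (F n).
Proof.
move=> oF; apply: ge_ereal_sup => _ [f [cf fU] <-].
apply/lee_addgt0Pr => e e0.
have /choice[phi hphi] := fun n => open_indic_approx (oF n).
have cphi i n : continuous (phi i n) by case: (hphi i).
have phiF i n x : (0 <= phi i n x <= \1_(F i) x)%R by case: (hphi i).
have ndphi i x n m : (n <= m)%N -> (phi i n x <= phi i m x)%R.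
  by case: (hphi i) => _ _ + _; exact.
pose S m x : R := (\sum_(i < m) phi i m x)%R.
have cS m : continuous (S m) by exact: (L_sum m (fun i => cphi i m)).1.
have [||||_ [[m ->] fS]] := @compact_directed_lt _ _
    [set h | exists m, h = fun x => (f x - S m x)%R] (fun=> e) cE.
- move=> _ [m ->] x; apply: cvgB; [exact: cf|exact: cS].
- exact: cst_continuous.
- have SS m n x : (m <= n)%N -> (S m x <= S n x)%R.
    move=> mn; rewrite /S (big_ord_widen n (fun i => phi i m x) mn).
    rewrite [leRHS](bigID (fun i : 'I_n => (i < m)%N))/=.
    apply: (@le_trans _ _ (\sum_(i < n | (i < m)%N) phi i n x)%R).
      by apply: ler_sum => i _; exact: ndphi.
    by rewrite lerDl; apply: sumr_ge0 => i _; have /andP[] := phiF i n x.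
  move=> _ _ [m ->] [n ->]; exists (fun x => f x - S (maxn m n) x)%R; split.
    by eexists.
  by move=> x; rewrite !lerB// SS// ?leq_maxl ?leq_maxr.
- move=> x; have /andP[fx0 fx1] := fU x.
  have [Ux|nUx] := pselect ((\bigcup_n F n) x); last first.
    exists (fun x => f x - S 0%N x)%R; split; first by eexists.
    rewrite /S big_ord0 subr0 (le_lt_trans fx1)// indicE memNset//.
  have [k _ Fkx] := Ux; have [_ _ _ /(_ x Fkx)[N hN]] := hphi k.
  exists (fun x => f x - S (maxn k.+1 N) x)%R; split; first by eexists.
  rewrite ltrBlDr (le_lt_trans fx1)// indicE mem_set//=.
  rewrite (@lt_le_trans _ _ (e + 1)%R)// ?ltrDr// lerD2l.
  have km : (k < maxn k.+1 N)%N by rewrite leq_max ltnSn.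
  rewrite /S (bigD1 (Ordinal km))//= hN ?leq_maxr// lerDl.
  by apply: sumr_ge0 => i _; have /andP[] := phiF i (maxn k.+1 N) x.
have [cSe LSe] := LDe e (cS m).
have [_ LS] := L_sum m (fun i => cphi i m).
apply: (@le_trans _ _ (L (S m) + e)%:E).
  rewrite lee_fin -LSe; apply: L_mono => // x.
  by have := fS x; rewrite ltrBlDr addrC => /ltW.
rewrite EFinD leeD2r// [L _]LS -sumEFin.
apply: (@le_trans _ _ (\sum_(i < m) riesz_content (F i))).
  by apply: lee_sum => i _; exact: content_ubound.
rewrite -(big_mkord xpredT (fun i => riesz_content (F i))).
exact: nneseries_lim_ge.
Qed.

Definition riesz_outer A : \bar R :=
  ereal_inf [set riesz_content U | U in [set U | open U /\ A `<=` U]].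

Let outer_le U A : open U -> A `<=` U -> riesz_outer A <= riesz_content U.
Proof. by move=> oU AU; apply: ereal_inf_lbound; exists U. Qed.

Let outer_open U : open U -> riesz_outer U = riesz_content U.
Proof.
move=> oU; apply/eqP; rewrite eq_le outer_le//=.
by apply: le_ereal_inf_tmp => _ [V [oV UV] <-]; exact: content_le.
Qed.

Let outer_ge0 A : 0 <= riesz_outer A.
Proof. by apply: le_ereal_inf_tmp => _ [V _ <-]. Qed.

Let outer_fin A : riesz_outer A \is a fin_num.
Proof.
rewrite ge0_fin_numE//; apply: (@le_lt_trans _ _ (riesz_content setT)).
  by apply: outer_le => //; exact: openT.
by rewrite contentT ltry.
Qed.

Let outer_mono A B : A `<=` B -> riesz_outer A <= riesz_outer B.
Proof.
move=> AB; apply: le_ereal_inf_tmp => _ [V [oV BV] <-]; apply: outer_le => //.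
exact: subset_trans BV.
Qed.

Let outer0 : riesz_outer set0 = 0.
Proof.
apply/eqP; rewrite eq_le outer_ge0 andbT outer_open; last exact: open0.
apply: ge_ereal_sup => _ [f [cf fU] <-]; rewrite lee_fin -L0.
apply: L_mono => //; first exact: cst_continuous.
by move=> x; have := fU x; rewrite indic0 => /andP[].
Qed.

Let outer_sigma_subadditive : sigma_subadditive riesz_outer.
Proof.
move=> F; apply/lee_addgt0Pr => e e0.
have /choice[U hU] : forall n, exists U : set E, [/\ open U, F n `<=` U &
    riesz_content U <= riesz_outer (F n) + (e / (2 ^ n.+1)%:R)%:E].
  move=> n; have en0 : (0 < e / (2 ^ n.+1)%:R)%R.
    by rewrite divr_gt0// ltr0n expn_gt0.
  have [_ [U [oU FU] <-] /ltW cU] :=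
    lb_ereal_inf_adherent en0 (outer_fin (F n)).
  by exists U.
apply: (@le_trans _ _ (riesz_content (\bigcup_n U n))).
  apply: outer_le; first by apply: bigcup_open => n _; case: (hU n).
  by apply: subset_bigcup => n _; case: (hU n).
apply: le_trans (content_sigma_subadditive _) _; first by move=> n; case: (hU n).
apply: le_trans (epsilon_trick xpredT _ (ltW e0)); last first.
  by move=> n; exact: outer_ge0.
apply: lee_nneseries => n *; first exact: content_ge0.
by case: (hU n).
Qed.

(** Let V be open and contain X, and f be below the indicator of V `&` U.  The
    open subset W of V where f < e contains X \ U, and there (f - e)^+ vanishes;
    so (f - e)^+ + g is below the indicator of V for all g below that of W.
    Hence L f - e + riesz_content W <= riesz_content V. *)
Let outer_caratheodory (mu : {outer_measure set E -> \bar R}) U :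
  (forall A, mu A = riesz_outer A) -> open U -> mu.-caratheodory U.
Proof.
move=> muE oU; apply: le_caratheodory_measurable => X; rewrite !muE.
apply: le_ereal_inf_tmp => _ [V [oV XV] <-].
have oVU : open (V `&` U) by exact: openI.
apply: (@le_trans _ _ (riesz_content (V `&` U) + riesz_outer (X `&` ~` U))).
  by rewrite leeD2r//; apply: outer_le => //; exact: setSI.
rewrite -leeBrDr//; apply: ge_ereal_sup => _ [f [cf fVU] <-].
rewrite leeBrDr//; apply/lee_addgt0Pr => e e0.
pose W := V `&` [set x | (f x < e)%R].
have oW : open W.
  by apply: openI => //; apply: open_lt_continuous => //; exact: cst_continuous.
have XW : X `&` ~` U `<=` W.
  move=> x [/XV Vx nUx]; split => //=; rewrite (le_lt_trans (andP (fVU x)).2)//.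
  by rewrite indicE memNset// => -[].
apply: (@le_trans _ _ ((L f)%:E + riesz_content W)).
  by rewrite leeD2l//; exact: outer_le.
rewrite addeC -leeBrDr//; apply: ge_ereal_sup => _ [g [cg gW] <-].
rewrite leeBrDr// addeC -EFinD.
pose f' x : R := Num.max (f x + - e)%R 0%R.
have cf' : continuous f'.
  by apply: max_fun_continuous; [exact: (LDe (- e) cf).1|exact: cst_continuous].
have cf'g : continuous (fun x => f' x + g x)%R.
  by move=> x; apply: cvgD; [exact: cf'|exact: cg].
apply: (@le_trans _ _ ((L (fun x => f' x + g x)%R : R)%:E + e%:E)); last first.
  rewrite leeD2r//; apply: content_ubound => // x.
  have /andP[fx0 fx1] := fVU x; have /andP[gx0 gx1] := gW x.
  have f'0 : (0 <= f' x)%R by rewrite /f' le_max lexx orbT.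
  rewrite addr_ge0//=; have [xe|ex] := ltP (f x) e.
    have -> : f' x = 0%R by apply/max_idPr; rewrite subr_le0 ltW.
    rewrite add0r (le_trans gx1)// !indicE ler_nat.
    by case: (boolP (x \in W)) => // /set_mem[/mem_set ->].
  have g0 : g x = 0%R.
    apply/eqP; rewrite eq_le gx0 andbT (le_trans gx1)// indicE memNset//.
    by move=> [_ /=]; rewrite ltNge ex.
  rewrite g0 addr0 /f' ge_max; apply/andP; split; last by rewrite indicE.
  rewrite lerBlDr (le_trans fx1)// (@le_trans _ _ (\1_V x))//; last first.
    by rewrite lerDl ltW.
  rewrite !indicE ler_nat; case: (boolP (x \in _)) => // /set_mem[/mem_set ->//].
rewrite -EFinD lee_fin LD// addrAC lerD2r.
rewrite -lerBlDr -(LDe (- e) cf).2; apply: L_mono => //.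
  exact: (LDe (- e) cf).1.
by move=> x; rewrite /f' le_max lexx.
Qed.

Lemma riesz_measure : exists mu : probability (borel E) R,
  forall U, open U -> mu U = riesz_content U.
Proof.
pose mu : {outer_measure set E -> \bar R} := HB.pack riesz_outer
  (isOuterMeasure.Build R E riesz_outer outer0 outer_ge0 outer_mono
     outer_sigma_subadditive).
have [||P PE] := @caratheodory_borel_probability R E mu.
- by move=> U; exact: outer_caratheodory.
- by rewrite [LHS]outer_open; [exact: contentT|exact: openT].
by exists P => U oU; rewrite PE [LHS]outer_open.
Qed.

Local Close Scope ereal_scope.

Let bounded_measure_integrable (mu : probability (borel E) R) f (M : R) :
  continuous f -> (forall x, `|f x| <= M) ->
  mu.-integrable setT (EFin \o (f : borel E -> R)).
Proof.
move=> cf fM; apply: (@probability_bounded_integrable _ _ _ _ _ M) => //.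
exact: continuous_borel_measurable.
Qed.

(** Slice f into the sum of g i = min(f, (i + 1) / n) - min(f, i / n) for i < n.
    The function n g i is below the indicator of U i, the set where f > i / n,
    so that n L f is at most the sum of the measures of the U i.  This sum is
    the integral of a function which exceeds n f by at most 1. *)
Let riesz_le (mu : probability (borel E) R) f :
  (forall U, open U -> mu U = riesz_content U) ->
  continuous f -> (forall x, 0 <= f x <= 1) -> L f <= \int[mu]_x f x.
Proof.
move=> muE cf f01; apply/ler_addgt0Pr => e e0.
pose n := (Num.truncn e^-1).+1; have n0 : 0 < n%:R :> R by rewrite ltr0n.
have ne : n%:R^-1 <= e.
  rewrite -[e]invrK lef_pV2 ?posrE ?invr_gt0//.
  by apply/ltW; rewrite truncnS_gt.
pose U i := [set x | i%:R / n%:R < f x].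
have oU i : open (U i) by apply: open_lt_continuous => //; exact: cst_continuous.
pose g i x := Num.min (f x) (i.+1%:R / n%:R) + - Num.min (f x) (i%:R / n%:R).
have cmin a : continuous (fun x => Num.min (f x) a).
  by apply: min_fun_continuous => //; exact: cst_continuous.
have cg i : continuous (g i).
  by move=> x; apply: cvgB; exact: cmin.
have in1 i : i%:R / n%:R <= i.+1%:R / n%:R :> R.
  by rewrite ler_pM2r ?invr_gt0// ler_nat.
have gU i x : 0 <= n%:R * g i x <= \1_(U i) x.
  rewrite pmulr_rge0// /g subr_ge0 le_min !ge_min !lexx in1 !orbT/=.
  rewrite indicE; have [/set_mem Ux|] := boolP (x \in U i); last first.
    rewrite notin_setE /U/= => /negP; rewrite -leNgt => fx.
    by rewrite !min_l ?subrr ?mulr0// (le_trans fx).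
  rewrite [X in - X]min_r; last exact: ltW.
  rewrite mulrC -ler_pdivlMr// mul1r lerBlDr ge_min; apply/orP; right.
  by rewrite -natr1 mulrDl mul1r addrC.
have fE : f = fun x => \sum_(i < n) g i x.
  apply/funext => x; rewrite -(big_mkord xpredT (fun i => g i x)).
  rewrite /g (telescope_sumr (fun i => Num.min (f x) (i%:R / n%:R)))//.
  have /andP[fx0 fx1] := f01 x.
  by rewrite mul0r divff ?gt_eqF// min_l// min_r// subr0.
have LE : L f = \sum_(i < n) L (g i) by rewrite {1}fE; exact: (L_sum n cg).2.
have mU i : measurable (U i : set (borel E)) by apply: open_borel; exact: oU.
have Lg i : L (g i) <= n%:R^-1 * fine (mu (U i)).
  rewrite ler_pdivlMl// -LZ// -lee_fin fineK ?fin_num_measure// muE//.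
  apply: content_ubound => //.
  by move=> x; apply: cvgM; [exact: cvg_cst|exact: cg].
pose I i : borel E -> R := \1_(U i).
have iI i : mu.-integrable setT (EFin \o I i).
  apply: (@probability_bounded_integrable _ _ _ _ _ 1).
    exact: measurable_indic.
  by move=> x; rewrite /I indicE ger0_norm ?lern1 ?leq_b1.
have iF : mu.-integrable setT (EFin \o (f : borel E -> R)).
  apply: (@bounded_measure_integrable _ _ 1) => // x.
  by have /andP[fx0 fx1] := f01 x; rewrite ger0_norm.
have IE : \int[mu]_x (\sum_(i < n) I i x) = \sum_(i < n) fine (mu (U i)).
  rewrite (Rintegral_sum measurableT _ (fun i : 'I_n => iI i)).
  by apply: eq_bigr => i _; rewrite /Rintegral integral_indic// setIT.
rewrite LE (@le_trans _ _ (n%:R^-1 * \sum_(i < n) fine (mu (U i))))//.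
  by rewrite mulr_sumr; apply: ler_sum => i _; exact: Lg.
rewrite -IE ler_pdivrMl//.
rewrite mulrDr (@le_trans _ _ (n%:R * \int[mu]_x f x + 1))//; last first.
  by rewrite lerD2l -ler_pdivrMl// mulr1.
rewrite -probability_Rintegral_affine//.
have cf1 : continuous (fun x => n%:R * f x + 1).
  exact: (LDe 1 (vector_spaceZ n%:R vC cf)).1.
have [M [_ f1M]] := continuous_compact_bounded cE cf1.
apply: le_Rintegral => //.
- exact: (integrable_sum_EFin measurableT _ (fun i : 'I_n => iI i)).
- exact: bounded_measure_integrable f1M.
move=> x _; have /andP[fx0 _] := f01 x.
apply: le_trans (sum_threshold_le n n fx0).
apply: ler_sum => i _; rewrite /I indicE ler_nat.
have [/set_mem|//] := boolP (x \in U i).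
by rewrite /U/= ltr_pdivrMr// mulrC => ->.
Qed.

Lemma riesz_representation : exists mu : probability (borel E) R,
  forall f, continuous f -> \int[mu]_x f x = L f.
Proof.
have [mu muE] := riesz_measure; exists mu => f cf.
have [M [M0 fM]] := continuous_compact_bounded cE cf.
have iF : mu.-integrable setT (EFin \o (f : borel E -> R)).
  exact: bounded_measure_integrable fM.
(* The inequality for f and for -f gives the equality; an affine map with slope
   c brings the values of f into [0, 1]. *)
suff H (s : R) : `|s| = 1 -> s * L f <= s * \int[mu]_x f x.
  apply/eqP; rewrite eq_le; apply/andP; split.
    by have := H (-1); rewrite normrN1 !mulN1r lerN2; apply.
  by have := H 1; rewrite normr1 !mul1r; apply.
move=> s1; pose c := s / (2 * M).
have cf' : continuous (fun x => c * f x + 2^-1).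
  exact: (LDe 2^-1 (vector_spaceZ c vC cf)).1.
have f01 x : 0 <= c * f x + 2^-1 <= 1.
  have : `|s * f x / M| <= 1.
    by rewrite !normrM s1 mul1r normfV (gtr0_norm M0) ler_pdivrMr// mul1r.
  rewrite ler_norml => /andP[? ?].
  have -> : c * f x = s * f x / M / 2 by rewrite /c; field; exact: lt0r_neq0.
  by apply/andP; split; lra.
have := riesz_le muE cf' f01.
rewrite probability_Rintegral_affine// (LDe _ (vector_spaceZ c vC cf)).2 lerD2r.
by rewrite LZ// /c ![s / _]mulrC -!mulrA ler_pM2l ?invr_gt0 ?mulr_gt0.
Qed.

End riesz.

(** * Positive functionals on an algebra of functions as probability kernels *)

Section kernel_representation.
Context {R : realType} {E : polishType R}.
Implicit Types (A : set (E -> R)) (f : E -> R).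

(** If A did not separate x and y, the constant sequence of Dirac measures at x
    would converge weakly to the Dirac measure at y, which the distance to x
    refutes. *)
Lemma convergence_determining_separates A : compact [set: E] ->
  convergence_determining A ->
  forall x y, x != y -> exists2 f, A f & f x != f y.
Proof.
move=> cE [ACb detA] x y xy; apply: contrapT => nsep.
have int_dirac (z : E) (f : E -> R) : continuous f ->
    \int[\d_(z : borel E) : probability (borel E) R]_u f u = f z.
  move=> cf; rewrite /Rintegral integral_dirac//=; first by rewrite indicT mul1r.
  by apply/measurable_EFinP; apply: continuous_borel_measurable.
have cd : continuous (mdist x).
  apply: continuous_of_dist => u v; rewrite ler_distl lerBlDr.
  rewrite metric_triangle/= (metric_sym u v); exact: metric_triangle.
have H := detA (fun=> \d_(x : borel E)) \d_(y : borel E).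
suff : mdist x x = mdist x y.
  by rewrite mdistxx => /esym/mdist_positivity; apply/eqP.
have : \int[\d_(x : borel E) : probability (borel E) R]_u mdist x u
    @[n --> \oo] -->
    \int[\d_(y : borel E) : probability (borel E) R]_u mdist x u.
  apply: (H).
    move=> f Af; rewrite !int_dirac; [|exact: (ACb _ Af).1..].
    suff -> : f x = f y by exact: cvg_cst.
    by apply/eqP/negPn/negP => fxy; apply: nsep; exists f.
  split; first exact: cd.
  have [M [_ dM]] := continuous_compact_bounded cE cd.
  exact: le_bounded_fun dM.
rewrite !int_dirac// => /cvg_lim <-//.
by rewrite lim_cst.
Qed.

Lemma positive_functional_representation A (L : (E -> R) -> R^o) :
  compact [set: E] -> algebra_on A -> A (fun=> 1) ->
  convergence_determining A ->
  linear_on A L -> positive_functional A L -> L (fun=> 1) = 1 ->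
  exists mu : probability (borel E) R, forall f, A f -> \int[mu]_x f x = L f.
Proof.
move=> cE aA A1 dA lL pL L1.
have cA f : A f -> continuous f by move=> /dA.1[].
have dens := stone_weierstrass cE aA A1 cA
  (convergence_determining_separates cE dA).
have [L' [lL' pL' LL']] := positive_functional_extension aA.1 lL pL A1 L1 dens.
have L'1 : L' (fun=> 1) = 1 by rewrite LL'.
have [mu muL] := riesz_representation cE lL' pL' L'1.
by exists mu => f Af; rewrite muL ?LL'//; exact: cA.
Qed.

(** Only measurability in x is new.  For U open, the indicator of U is a bounded
    pointwise limit of members a n of A, so x |-> k x U is a pointwise limit of
    the functions x |-> L x (a n); open sets generate the Borel sets and are
    stable under intersection. *)
Lemma kernel_representation d (X : measurableType d) A
    (L : X -> (E -> R) -> R^o) :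
  compact [set: E] -> algebra_on A -> A (fun=> 1) ->
  convergence_determining A ->
  (forall x, linear_on A (L x)) -> (forall x, positive_functional A (L x)) ->
  (forall x, L x (fun=> 1) = 1) ->
  (forall f, A f -> measurable_fun setT (fun x => L x f : R)) ->
  exists k : R.-pker X ~> borel E,
    forall x f, A f -> \int[k x]_y f y = L x f.
Proof.
move=> cE aA A1 dA lL pL L1 mL.
have /choice[k kL] x := positive_functional_representation cE aA A1 dA
  (lL x) (pL x) (L1 x).
have cA f : A f -> continuous f by move=> /dA.1[].
have dens := stone_weierstrass cE aA A1 cA
  (convergence_determining_separates cE dA).
have m_open U : open U -> measurable_fun setT (fun x => k x U).
  move=> oU; have [phi [cphi phiU _ phi1]] := open_indic_approx oU.
  have /choice[a aphi] n : exists g,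
      A g /\ forall x, `|phi n x - g x| <= n.+1%:R^-1.
    have n0 : 0 < n.+1%:R^-1 :> R by rewrite invr_gt0.
    by have [g Ag phig] := dens _ (cphi n) _ n0; exists g.
  have a2 n y : `|a n y| <= 2.
    have n1 : n.+1%:R^-1 <= 1 :> R by rewrite invf_le1// ler1n.
    have /andP[p0 /le_trans p1] := phiU n y.
    have {}p1 : phi n y <= 1 by apply: p1; rewrite indicE lern1 leq_b1.
    have := le_trans ((aphi n).2 y) n1.
    by rewrite !ler_norml => /andP[? ?]; apply/andP; split; lra.
  have a_cvg y : a n y @[n --> \oo] --> (\1_U y : R).
    have phi_cvg : phi n y @[n --> \oo] --> (\1_U y : R).
      have [Uy|nUy] := pselect (U y).
        have [N hN] := phi1 _ Uy; rewrite indicE mem_set//.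
        by apply: cvg_near_cst; exists N => // n /= /hN.
      rewrite indicE memNset//; apply: cvg_near_cst; apply: nearW => n.
      apply/eqP; rewrite eq_le; have := phiU n y.
      by rewrite indicE memNset// => /andP[-> ->].
    rewrite -[\1_U y]subr0.
    have -> : (fun n => a n y) = (fun n => phi n y - (phi n y - a n y)).
      by apply/funext => n; rewrite subKr.
    apply: cvgB => //; apply: norm_cvg0.
    apply: (squeeze_cvgr _ (cvg_cst 0) cvg_harmonic).
    by apply: nearW => n; rewrite normr_ge0; exact: (aphi n).2.
  have mkU : measurable_fun setT (fun x => fine (k x U)).
    apply: (measurable_fun_cvg (h := fun n x => L x (a n))).
      by move=> n; apply: mL; exact: (aphi n).1.
    move=> x _; rewrite (_ : fine _ = \int[k x]_y (\1_U y)); last first.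
      rewrite /Rintegral integral_indic ?setIT//; exact: open_borel.
    have -> : (fun n => L x (a n)) = (fun n => \int[k x]_y a n y).
      by apply/funext => n; rewrite kL//; exact: (aphi n).1.
    apply: (bounded_Rintegral_cvg measurableT (M := 2)) => //.
    - by rewrite [X in (X < _)%E](_ : _ = 1%E) ?ltry//; exact: probability_setT.
    - move=> n; apply: continuous_borel_measurable.
      exact: (cA _ (aphi n).1).
    - by apply: measurable_indic; exact: open_borel.
    - by apply: aeW => y _; exact: a_cvg.
  rewrite (_ : (fun x => k x U) = (EFin \o (fun x => fine (k x U)))).
    exact/measurable_EFinP.
  apply/funext => x /=; rewrite fineK// fin_num_measure//; exact: open_borel.
have m_all U : measurable U -> measurable_fun setT (fun x => k x U).
  move: U; apply: (@dynkin_induction _ (borel E) (@open E)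
    [set U | measurable_fun setT (fun x => k x U)]) => //.
  - by move=> U V; exact: openI.
  - by apply: m_open; exact: openT.
  - move=> U mU /= kU.
    have -> : (fun x => k x (~` U)) = (fun x => 1 - k x U)%E.
      by apply/funext => x; rewrite probability_setC.
    by apply: emeasurable_funB => //.
  - move=> F mF tF kF /=.
    have -> : (fun x => k x (\bigcup_n F n)) =
        (fun x => \sum_(n <oo) k x (F n))%E.
      apply/funext => x; rewrite measure_semi_bigcup//.
      exact: bigcup_measurable.
    by apply: ge0_emeasurable_sum => n *; [exact: measure_ge0|exact: kF].
pose k' (x : X) : {measure set (borel E) -> \bar R} := k x.
pose K0 : R.-ker X ~> borel E := HB.pack k'
  (isKernel.Build _ _ X (borel E) R k' m_all).
have K1 x : K0 x setT = 1%E by exact: probability_setT.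
pose K : R.-pker X ~> borel E := HB.pack (Kernel.sort K0)
  (Kernel_isProbability.Build _ _ X (borel E) R (Kernel.sort K0) K1).
by exists K => x f Af; exact: kL.
Qed.

End kernel_representation.

(** * Right-continuous paths *)

Section right_continuous_processes.
Context {R : realType}.

(** The first point strictly to the right of s on the grid of mesh 1 / (n + 1):
    approximation from the right is all that right-continuity can use. *)
Definition right_grid (n : nat) (s : R) : R :=
  (Num.floor (s * n.+1%:R) + 1)%:~R / n.+1%:R.

Lemma right_grid_gt n s : s < right_grid n s.
Proof. by rewrite ltr_pdivlMr// floorD1_gt. Qed.

Lemma right_grid_le n s : right_grid n s <= s + n.+1%:R^-1.
Proof.
rewrite ler_pdivrMr// mulrDl mulVf// intrD lerD2r.
exact: floor_le.
Qed.

Lemma cvg_right_grid s : right_grid n s @[n --> \oo] --> s.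
Proof.
apply: (@squeeze_cvgr _ _ _ _ (fun=> s) (fun n => s + n.+1%:R^-1)).
- by apply: nearW => n; rewrite ltW ?right_grid_gt//= right_grid_le.
- exact: cvg_cst.
- rewrite -[X in _ --> X]addr0.
  by apply: cvgD; [exact: cvg_cst|exact: cvg_harmonic].
Qed.

Lemma cvg_at_right_seq (f : R -> R) (p l : R) (u : nat -> R) :
  f x @[x --> p^'+] --> l -> (forall n, p < u n) -> u n @[n --> \oo] --> p ->
  f (u n) @[n --> \oo] --> l.
Proof. by move=> /cvg_at_rightP fl pu up; exact: fl. Qed.

(** Replacing the time by its right neighbour on a grid makes the process
    piecewise constant in time over countably many intervals. *)
Lemma measurable_right_continuous_process d (T : measurableType d)
    (F : R -> T -> R) :
  (forall s, measurable_fun setT (F s)) ->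
  (forall s w, F r w @[r --> s^'+] --> F s w) ->
  measurable_fun setT (fun p : T * R => F p.2 p.1).
Proof.
move=> mF rF.
apply: (measurable_fun_cvg
  (h := fun n (p : T * R) => F (right_grid n p.2) p.1)).
  move=> n _ B mB; rewrite setTI.
  have -> : (fun p : T * R => F (right_grid n p.2) p.1) @^-1` B =
    \bigcup_(k : int) ((F ((k + 1)%:~R / n.+1%:R) @^-1` B) `*`
                [set s | Num.floor (s * n.+1%:R) = k]).
    apply/seteqP; split => [[w s] /= Bws|[w s] [k _ [/= Bws sk]]].
      by exists (Num.floor (s * n.+1%:R)).
    by rewrite /right_grid sk.
  apply: countable_bigcupT_measurable => [|k]; first exact: countableP.
  apply: measurableX.
    by rewrite -[X in measurable X]setTI; exact: mF.
  rewrite (_ : mkset _ = `[k%:~R / n.+1%:R, (k + 1)%:~R / n.+1%:R[%classic).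
    exact: measurable_itv.
  apply/seteqP; split => s /=; rewrite in_itv/= ler_pdivrMr// ltr_pdivlMr//.
    by move=> <-; rewrite floor_le floorD1_gt.
  by move=> ?; exact: floor_def.
move=> [w s] _ /=; apply: (@cvg_at_right_seq (fun r => F r w) s) => //.
- by move=> n; exact: right_grid_gt.
- exact: cvg_right_grid.
Qed.

Lemma measurable_right_continuous (f : R -> R) :
  (forall s, f r @[r --> s^'+] --> f s) -> measurable_fun setT f.
Proof.
move=> rf; have := @measurable_right_continuous_process _ unit (fun s _ => f s).
move=> /(_ (fun s => measurable_cst _) (fun s _ => rf s)) mf.
exact: (measurableT_comp mf (pair1_measurable tt)).
Qed.

(** Let D k be the set of times near which u does not stay within 1 / (k + 1) of
    its value.  Right-continuity at s keeps some interval to the right of s free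
    of D k, so choosing a rational in that interval is injective on D k. *)
Lemma right_continuous_countable_discontinuities (E : polishType R)
    (u : R -> E) :
  (forall s, u r @[r --> s^'+] --> u s) ->
  countable [set s | ~ (u r @[r --> s] --> u s)].
Proof.
move=> ru.
pose D k := [set s | ~ exists2 r : R, 0 < r & forall a, `|a - s| < r ->
  mdist (u s) (u a) < k.+1%:R^-1].
apply: (@sub_countable _ _ _ (\bigcup_k D k)).
  apply: subset_card_le => s /= us; apply: contrapT => nDs; apply: us.
  apply/cvg_ballP => e e0; pose k := Num.truncn e^-1.
  have ke : k.+1%:R^-1 <= e.
    by rewrite -[e]invrK lef_pV2 ?posrE ?invr_gt0// ltW// truncnS_gt.
  have [r r0 ur] : exists2 r : R, 0 < r & forall a, `|a - s| < r ->
      mdist (u s) (u a) < k.+1%:R^-1.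
    by apply: contrapT => nr; apply: nDs; exists k.
  apply/nbhs_ballP; exists r => //= a sa; rewrite ballEmdist/=.
  by apply: lt_le_trans ke; apply: ur; rewrite distrC.
apply: bigcup_countable => // k _.
have /choice[q hq] s : exists q : rat, s < ratr q /\
    forall p, s < p < ratr q -> ~ D k p.
  have k20 : 0 < k.+1%:R^-1 / 2 :> R by rewrite divr_gt0// invr_gt0.
  have /cvg_ballP/(_ _ k20) := ru s => -[r /= r0 ur].
  have {}ur a : s < a < s + r -> mdist (u s) (u a) < k.+1%:R^-1 / 2.
    move=> /andP[sa asr]; have := ur a; rewrite /ball_/= ballEmdist; apply => //.
    by rewrite ltr_distlC ltrBlDr; apply/andP; split; lra.
  have /(@rat_in_itvoo R)[q] : s < s + r by rewrite ltrDl.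
  rewrite in_itv/= => /andP[sq qr]; exists q; split => // p /andP[sp pq]; apply.
  exists (Num.min (p - s) (ratr q - p)).
    by rewrite lt_min !subr_gt0 sp.
  move=> a; rewrite lt_min !ltr_distl => /andP[/andP[? ?] /andP[? ?]].
  rewrite (le_lt_trans (metric_triangle (u p) (u s) (u a)))//.
  rewrite [ltRHS]splitr ltrD// ?[mdist (u p) _]metric_sym; apply: ur;
    by apply/andP; split; lra.
apply/countable_injP; exists (fun s => choice.pickle (q s)) => s s'.
rewrite !inE => Ds Ds' /(pcan_inj choice.pickleK) qq.
case: (ltgtP s s') => // ss'.
  have [sq /(_ s')] := hq s; rewrite ss' qq (hq s').1 => /(_ isT).
  by move=> /(_ Ds').
have [sq /(_ s)] := hq s'; rewrite ss' -qq (hq s).1 => /(_ isT).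
by move=> /(_ Ds).
Qed.

End right_continuous_processes.

(** * Integrals over a compact time interval *)

Section interval_integrals.
Context {R : realType}.
Implicit Types (f : R -> R) (a b M : R).

Lemma lebesgue_measure_itv_lty a b : (@lebesgue_measure R `[a, b] < +oo)%E.
Proof. by rewrite lebesgue_measure_itv/=; case: ifP => //; rewrite ltry. Qed.

Lemma fine_lebesgue_measure_itv a b : a <= b ->
  fine (@lebesgue_measure R `[a, b]) = b - a.
Proof.
rewrite lebesgue_measure_itv/= le_eqVlt lte_fin => /predU1P[->|->//].
by rewrite ltxx subrr.
Qed.

Lemma bounded_integrable_itv f a b M : measurable_fun setT f ->
  (forall s, s \in `[a, b] -> `|f s| <= M) ->
  (@lebesgue_measure R).-integrable `[a, b] (EFin \o f).
Proof.
move=> mf fM; apply: (@le_bounded_integrable _ _ _ _ _ _ _ M) => //.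
- exact: lebesgue_measure_itv_lty.
- exact: measurable_funTS.
Qed.

Lemma norm_Rintegral_itv_le f a b M : a <= b -> measurable_fun setT f ->
  (forall s, s \in `[a, b] -> `|f s| <= M) ->
  `|\int[lebesgue_measure]_(s in `[a, b]) f s| <= M * (b - a).
Proof.
move=> ab mf fM; rewrite -(fine_lebesgue_measure_itv ab).
apply: norm_Rintegral_le => //.
- exact: lebesgue_measure_itv_lty.
- exact: measurable_funTS.
Qed.

End interval_integrals.

Section fubini_interval.
Context {R : realType} d (T : measurableType d) (P : probability T R).
Variables (F : T -> R -> R) (a b M : R).
Hypothesis mF : measurable_fun setT (fun p : T * R => F p.1 p.2).
Hypothesis FM : forall w s, s \in `[a, b] -> `|F w s| <= M.

Let D : set (T * measurableTypeR R) := setT `*` `[a, b]%classic.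

(* Restriction by [D] reduces the statements over [a, b] to those over the whole
   product space. *)
Let f := (EFin \o (fun p : T * measurableTypeR R => F p.1 p.2)) \_ D.

Let mFw w : measurable_fun setT (F w).
Proof. exact: (measurableT_comp mF (pair1_measurable w)). Qed.

Let mFs s : measurable_fun setT (F ^~ s).
Proof. exact: (measurableT_comp mF (pair2_measurable s)). Qed.

Let mD : measurable D.
Proof. by apply: measurableX => //; exact: measurable_itv. Qed.

Let iF : (P \x @lebesgue_measure R)%E.-integrable setT f.
Proof.
apply: (integrable_mkcond _ mD).1.
apply: (@le_bounded_integrable _ _ _ _ _ mD _ M).
- rewrite [ltLHS](product_measure1E P lebesgue_measure measurableT)//.
  by rewrite [X in (X * _)%E](_ : _ = 1%E) ?mul1e;
    [exact: lebesgue_measure_itv_lty|exact: probability_setT].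
- exact: measurable_funTS.
- by move=> [w s] [_ /= sab]; exact: FM.
Qed.

Let iFw w : (@lebesgue_measure R).-integrable `[a, b] (EFin \o F w).
Proof.
by apply: (@bounded_integrable_itv _ _ _ _ M); [exact: mFw|exact: FM].
Qed.

Let fw w : (\int[@lebesgue_measure R]_s f (w, s))%E =
  (\int[@lebesgue_measure R]_(s in `[a, b]) F w s)%:E.
Proof.
rewrite /Rintegral fineK; last exact: integrable_fin_num (iFw w).
rewrite [RHS]integral_mkcond; apply: eq_integral => s _.
by rewrite /f /patch /D in_setX in_setT.
Qed.

Let fs : (\int[@lebesgue_measure R]_s \int[P]_w f (w, s))%E =
  (\int[@lebesgue_measure R]_(s in `[a, b]) (\int[P]_w F w s)%:E)%E.
Proof.
rewrite [RHS]integral_mkcond; apply: eq_integral => s _; rewrite [RHS]patchE.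
rewrite -[in LHS]/(\int[P]_w (f (w, s)))%E.
case: ifPn => sab.
  rewrite /Rintegral fineK; last first.
    apply: integrable_fin_num => //.
    apply: (@probability_bounded_integrable _ _ _ _ _ M) => // w.
    by apply: FM; move: sab; rewrite inE.
  by apply: eq_integral => w _; rewrite /f patchE /D in_setX in_setT sab.
rewrite -[RHS](integral0 P setT); apply: eq_integral => w _.
by rewrite /f patchE /D in_setX in_setT (negbTE sab).
Qed.

Lemma measurable_Rintegral_itv :
  measurable_fun setT (fun w => \int[@lebesgue_measure R]_(s in `[a, b]) F w s).
Proof.
have := measurable_fubini_F iF; rewrite /fubini_F.
under eq_fun do rewrite fw.
by move/measurable_EFinP.
Qed.

Lemma Rintegral_itv_Fubini :
  \int[P]_w \int[@lebesgue_measure R]_(s in `[a, b]) F w s =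
  \int[@lebesgue_measure R]_(s in `[a, b]) \int[P]_w F w s.
Proof.
rewrite [LHS]/Rintegral [RHS]/Rintegral; congr fine.
have := Fubini iF; rewrite fs => <-.
by apply: eq_integral => w _; rewrite fw.
Qed.

End fubini_interval.

(** * The Feynman-Kac weight along a path *)

Section path_functionals.
Context {R : realType} {E : polishType R}.
Implicit Types (w v : R -> E) (s t T : R).

(** Paths matter at nonnegative times only.  Freezing them before time 0 makes
    a cadlag path right-continuous on the whole real line. *)
Definition clip w s : E := w (Num.max s 0).

Lemma clipE w s : 0 <= s -> clip w s = w s.
Proof. by move=> s0; rewrite /clip max_l. Qed.

Lemma cvg_clip w s : cadlag w -> clip w r @[r --> s^'+] --> clip w s.
Proof.
move=> [rw _]; have [s0|s0] := leP 0 s.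
  rewrite clipE//; apply: cvg_trans (rw _ s0).
  have e : \forall r \near s^'+, w r = clip w r.
    by near=> r; rewrite clipE// (le_trans s0)// ltW.
  exact: (near_eq_cvg e).
rewrite {2}/clip max_r; last exact: ltW.
by apply: cvg_near_cst; near=> r; rewrite /clip max_r// ltW.
Unshelve. all: by end_near. Qed.

Lemma cvg_comp_clip (f : E -> R) w s : continuous f -> cadlag w ->
  f (clip w r) @[r --> s^'+] --> f (clip w s).
Proof.
by move=> cf cw; apply: continuous_cvg; [exact: cf|exact: cvg_clip].
Qed.

Lemma measurable_comp_clip (f : E -> R) w : continuous f -> cadlag w ->
  measurable_fun setT (fun s => f (clip w s)).
Proof.
by move=> cf cw; apply: measurable_right_continuous => s; exact: cvg_comp_clip.
Qed.

Variables (beta g : E -> R) (B G : R).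
Hypotheses (cbeta : continuous beta) (cg : continuous g).
Hypotheses (betaB : forall x, `|beta x| <= B) (gG : forall x, `|g x| <= G).

Definition path_exponent w t : R :=
  \int[lebesgue_measure]_(s in `[0, t]) beta (clip w s).

Definition path_weight w t : R := g (clip w t) * expR (path_exponent w t).

Let B0 : 0 <= B. Proof. exact: le_trans (normr_ge0 _) (betaB point). Qed.

Let integrable_beta w a b : cadlag w ->
  (@lebesgue_measure R).-integrable `[a, b] (EFin \o (fun s => beta (clip w s))).
Proof.
move=> cw; apply: (@bounded_integrable_itv _ _ _ _ B) => //.
exact: measurable_comp_clip.
Qed.

Lemma path_exponent_le w t T : cadlag w -> 0 <= T -> t <= T ->
  `|path_exponent w t| <= B * T.
Proof.
move=> cw T0 tT; have [t0|t0] := ltP t 0.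
  rewrite /path_exponent set_itv_ge ?bnd_simp -?ltNge// Rintegral_set0 normr0.
  exact: mulr_ge0.
apply: (@le_trans _ _ (B * t)); last by rewrite ler_wpM2l.
rewrite -[X in _ <= B * X]subr0; apply: norm_Rintegral_itv_le => //.
exact: measurable_comp_clip.
Qed.

Lemma cvg_path_exponent w t : cadlag w ->
  path_exponent w r @[r --> t^'+] --> path_exponent w t.
Proof.
move=> cw; have [t0|t0] := ltP t 0.
  apply: cvg_near_cst; near=> r.
  have r0 : r < 0 by near: r; exact: nbhs_right_lt.
  by rewrite /path_exponent !set_itv_ge ?bnd_simp -?ltNge.
apply/cvgrPdist_le => e e0; near=> r.
have tr : t < r by near: r; exact: nbhs_right_gt.
have rB : r < t + e / (B + 1).
  by near: r; apply: nbhs_right_lt; rewrite ltrDl divr_gt0// ltr_pwDr.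
rewrite distrC /path_exponent.
rewrite (Rintegral_itvB (integrable_beta _ _ cw)) ?bnd_simp//.
rewrite Rintegral_itv_obnd_cbnd; last first.
  by apply: integrableS (integrable_beta t r cw) => //; exact: subset_itv_oc_cc.
apply: (@le_trans _ _ (B * (r - t))).
  by apply: norm_Rintegral_itv_le; [exact: ltW|exact: measurable_comp_clip|].
have B1 : 0 < B + 1 by rewrite ltr_pwDr.
move: rB; rewrite -ltrBlDl ltr_pdivlMr// => H; nra.
Unshelve. all: by end_near. Qed.

Lemma cvg_path_weight w t : cadlag w ->
  path_weight w r @[r --> t^'+] --> path_weight w t.
Proof.
move=> cw; apply: cvgM; first exact: cvg_comp_clip.
apply: continuous_cvg; first exact: continuous_expR.
exact: cvg_path_exponent.
Qed.

Lemma path_weight_le w t T : cadlag w -> 0 <= T -> t <= T ->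
  `|path_weight w t| <= G * expR (B * T).
Proof.
move=> cw T0 tT; rewrite normrM ler_pM// ger0_norm ?expR_ge0// ler_expR.
exact: le_trans (ler_norm _) (path_exponent_le cw T0 tT).
Qed.

Lemma measurable_path_weight w : cadlag w -> measurable_fun setT (path_weight w).
Proof.
by move=> cw; apply: measurable_right_continuous => t; exact: cvg_path_weight.
Qed.

End path_functionals.

(** * Skorokhod continuity of time averages *)

Section skorokhod_continuity.
Context {R : realType} {E : polishType R}.
Implicit Types (w : R -> E) (s t : R).

Lemma ae_continuous_clip w : cadlag w ->
  {ae @lebesgue_measure R, forall s, clip w r @[r --> s] --> clip w s}.
Proof.
move=> cw; have cN := right_continuous_countable_discontinuities
  (fun s => @cvg_clip _ _ w s cw).
exists [set s | ~ (clip w r @[r --> s] --> clip w s)]; split => //.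
- by apply: countable_measurable => // s; exact: measurable_set1.
- exact: countable_lebesgue_measure0.
Qed.

(** The values v n s are close to w (l s) for a time change l that moves s by at
    most 1 / (n + 1), so continuity of the limit path at s suffices. *)
Lemma skorokhod_close_cvg w (v : nat -> R -> E) T s :
  (forall n, skorokhod_close w T n.+1%:R^-1 (v n)) -> 0 <= s <= T ->
  clip w r @[r --> s] --> clip w s ->
  clip (v n) s @[n --> \oo] --> clip w s.
Proof.
move=> wv sT ws; have /andP[s0 _] := sT; apply/cvg_ballP => e e0.
have e20 : 0 < e / 2 by rewrite divr_gt0.
have /cvg_ballP/(_ _ e20)[r /= r0 wr] := ws.
near=> n; have [l [lmono limg] /(_ s sT)[ls vs]] := wv n.
have ls0 : 0 <= l s by have : [set t | 0 <= t] (l s) by rewrite -limg; exists s.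
rewrite (clipE (v n) s0) ballEmdist/=.
rewrite (le_lt_trans (metric_triangle _ (w (l s)) _))// [ltRHS]splitr ltr_leD//.
  rewrite -(clipE w ls0); have := wr (l s); rewrite ballEmdist/=; apply.
  rewrite distrC (le_lt_trans ls)//.
  by near: n; exact: (near_infty_natSinv_lt (PosNum r0)).
rewrite metric_sym (le_trans vs)// ltW//.
by near: n; exact: (near_infty_natSinv_lt (PosNum e20)).
Unshelve. all: by end_near. Qed.

Variables (beta g : E -> R) (B G : R).
Hypotheses (cbeta : continuous beta) (cg : continuous g).
Hypotheses (betaB : forall x, `|beta x| <= B) (gG : forall x, `|g x| <= G).

Let cvg_exponent w (v : nat -> R -> E) T t : cadlag w ->
  (forall n, cadlag (v n)) ->
  (forall n, skorokhod_close w T n.+1%:R^-1 (v n)) -> t <= T ->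
  path_exponent beta (v n) t @[n --> \oo] --> path_exponent beta w t.
Proof.
move=> cw cv wv tT; apply: (bounded_Rintegral_cvg _ (M := B)) => //.
- exact: lebesgue_measure_itv_lty.
- by move=> n; apply: measurable_funTS; exact: measurable_comp_clip.
- by apply: measurable_funTS; exact: measurable_comp_clip.
have [N [mN N0 sN]] := ae_continuous_clip cw; exists N; split => //.
apply: subset_trans sN => s; apply: contra_not => ws.
rewrite /= in_itv/= => /andP[s0 st]; apply: continuous_cvg; first exact: cbeta.
apply: (skorokhod_close_cvg wv) => //.
by rewrite s0 (le_trans st).
Qed.

(** If the continuity failed at w, some sequence of paths would approach w with
    integrals that stay away.  But along this sequence the weights converge at
    almost all times, and they are bounded uniformly on [a, b]. *)
Lemma skorokhod_continuous_path_weight a b : 0 <= a <= b ->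
  skorokhod_continuous
    (fun w => \int[lebesgue_measure]_(s in `[a, b]) path_weight beta g w s).
Proof.
move=> /andP[a0 ab] w cw e e0; have b0 := le_trans a0 ab.
apply: contrapT => nH.
have /choice[v hv] (n : nat) : exists v : R -> E, [/\ cadlag v,
    skorokhod_close w b n.+1%:R^-1 v &
    ~ `|\int[lebesgue_measure]_(s in `[a, b]) path_weight beta g v s -
        \int[lebesgue_measure]_(s in `[a, b]) path_weight beta g w s| <= e].
  apply: contrapT => nv; apply: nH; exists b, n.+1%:R^-1; split.
    by rewrite invr_gt0.
  by move=> v cv wv; apply: contrapT => nle; apply: nv; exists v.
have cv n : cadlag (v n) by case: (hv n).
have wv n : skorokhod_close w b n.+1%:R^-1 (v n) by case: (hv n).
have : \int[lebesgue_measure]_(s in `[a, b]) path_weight beta g (v n) s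
    @[n --> \oo] -->
    \int[lebesgue_measure]_(s in `[a, b]) path_weight beta g w s.
  apply: (bounded_Rintegral_cvg _ (M := G * expR (B * b))) => //.
  - exact: lebesgue_measure_itv_lty.
  - move=> n; apply: measurable_funTS.
    exact: (measurable_path_weight cbeta cg betaB).
  - by apply: measurable_funTS; exact: (measurable_path_weight cbeta cg betaB).
  - move=> n s; rewrite /= in_itv/= => /andP[_ sb].
    exact: (path_weight_le cbeta betaB gG).
  have [N [mN N0 sN]] := ae_continuous_clip cw; exists N; split => //.
apply: subset_trans sN => s; apply: contra_not => ws.
  rewrite /= in_itv/= => /andP[sa sb]; apply: cvgM.
    apply: continuous_cvg; first exact: cg.
    by apply: (skorokhod_close_cvg wv) => //; rewrite sb (le_trans a0).
  apply: continuous_cvg; first exact: continuous_expR.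
  exact: (cvg_exponent cw cv wv).
move=> /cvgrPdist_le/(_ _ e0)[N _ /(_ N (leqnn N))].
by rewrite distrC => H; have [_ _] := hv N; apply.
Qed.

End skorokhod_continuity.

(** * Feynman-Kac expectations as functions of time *)

Section feynman_kac_averages.
Context {R : realType} {E : polishType R} (Z : markovProcess E).
Hypothesis cZ : forall o : mp_space Z, cadlag (fun t => mp_path t o).
Variables (beta g : E -> R) (B G : R).
Hypotheses (cbeta : continuous beta) (cg : continuous g).
Hypotheses (betaB : forall x, `|beta x| <= B) (gG : forall x, `|g x| <= G).

Let path (o : mp_space Z) : R -> E := fun t => mp_path t o.

Let measurable_state (f : E -> R) s : continuous f ->
  measurable_fun setT (fun o => f (clip (path o) s)).
Proof.
move=> cf; apply: (measurableT_comp (continuous_borel_measurable cf)).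
by apply: mp_process; rewrite le_max lexx orbT.
Qed.

Let measurable_exponent t :
  measurable_fun setT (fun o => path_exponent beta (path o) t).
Proof.
apply: (@measurable_Rintegral_itv _ _ _ (mp_law Z point)
  (fun o s => beta (clip (path o) s)) 0 t B) => //.
apply: (@measurable_right_continuous_process _ _ _
  (fun s o => beta (clip (path o) s))).
- by move=> s; apply: measurable_state.
- by move=> s o; exact: (cvg_comp_clip cbeta (cZ o)).
Qed.

Let measurable_weight t :
  measurable_fun setT (fun o => path_weight beta g (path o) t).
Proof.
apply: measurable_funM; first exact: measurable_state.
exact: (measurableT_comp (continuous_measurable_fun (@continuous_expR R))
  (measurable_exponent t)).
Qed.

Let measurable_weight_pair : measurable_fun setT
  (fun p : mp_space Z * R => path_weight beta g (path p.1) p.2).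
Proof.
apply: (@measurable_right_continuous_process _ _ _
  (fun s o => path_weight beta g (path o) s)) => //.
by move=> s o; exact: (cvg_path_weight cbeta cg betaB (cZ o)).
Qed.

(** By [feynman_kacE] this is the Feynman-Kac expectation, extended to negative
    times so that it is right-continuous on the whole real line. *)
Definition mean_weight (z : E) (t : R) : R :=
  mp_expectation Z z (fun o => path_weight beta g (path o) t).

Lemma feynman_kacE t z : 0 <= t -> feynman_kac Z beta g t z = mean_weight z t.
Proof.
move=> t0; rewrite /feynman_kac /mean_weight /mp_expectation.
apply: eq_Rintegral => o _; rewrite /path_weight (clipE _ t0).
congr (_ * expR _); apply: eq_Rintegral => s.
by rewrite inE/= in_itv/= => /andP[s0 _]; rewrite clipE.
Qed.

Lemma cvg_mean_weight z t : mean_weight z r @[r --> t^'+] --> mean_weight z t.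
Proof.
apply/cvg_at_rightP => u [tu ut].
have [T T0 uT] : exists2 T, 0 <= T & forall n, u n <= T.
  have : cvg (u n @[n --> \oo]) by apply/cvg_ex; exists t.
  move=> /cvg_seq_bounded/bounded_fun_le[T [T0 uT]].
  by exists T; [exact: ltW|move=> n; exact: le_trans (ler_norm _) (uT n)].
apply: (bounded_Rintegral_cvg measurableT (M := G * expR (B * T))) => //.
- by rewrite [ltLHS](_ : _ = 1%E) ?ltry//; exact: probability_setT.
- by move=> n o _; exact: (path_weight_le cbeta betaB gG (cZ o)).
- apply: aeW => o _; apply: cvg_at_right_seq tu ut.
  exact: (cvg_path_weight cbeta cg betaB (cZ o)).
Qed.

Lemma measurable_mean_weight z : measurable_fun setT (mean_weight z).
Proof. by apply: measurable_right_continuous => s; exact: cvg_mean_weight. Qed.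

Lemma mean_weight_le z t T : 0 <= T -> t <= T ->
  `|mean_weight z t| <= G * expR (B * T).
Proof.
move=> T0 tT; rewrite -[leRHS]mulr1.
have -> : 1 = fine (mp_law Z z setT) by rewrite probability_setT.
apply: (norm_Rintegral_le measurableT) => //.
- by rewrite [ltLHS](_ : _ = 1%E) ?ltry//; exact: probability_setT.
- by move=> o _; exact: (path_weight_le cbeta betaB gG (cZ o)).
Qed.

Lemma mean_integral_weight z a b : 0 <= b ->
  mp_expectation Z z (fun o =>
    \int[lebesgue_measure]_(s in `[a, b]) path_weight beta g (path o) s) =
  \int[lebesgue_measure]_(s in `[a, b]) mean_weight z s.
Proof.
move=> b0.
apply: (@Rintegral_itv_Fubini _ _ _ (mp_law Z z) _ a b (G * expR (B * b))) => //.
move=> o s; rewrite in_itv/= => /andP[_ sb].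
exact: (path_weight_le cbeta betaB gG (cZ o)).
Qed.

End feynman_kac_averages.

(** * Bounds for the dual functionals in the limit *)

Lemma cvg_ord_sum (R : realType) (I : Type) (F : set_system I) (FF : Filter F) n
    (u : 'I_n -> I -> R) (l : 'I_n -> R) :
  (forall i, u i r @[r --> F] --> l i) ->
  \sum_(i < n) u i r @[r --> F] --> \sum_(i < n) l i.
Proof.
elim: n u l => [|n IH] u l ul.
  by under eq_fun do rewrite big_ord0; rewrite big_ord0; exact: cvg_cst.
under eq_fun do rewrite big_ord_recl; rewrite big_ord_recl.
by apply: cvgD => //; apply: IH.
Qed.

Section duality_bounds.
Context {R : realType} {EX EY : polishType R}.
Variables (H : EX * EY -> R) (beta : EY -> R).
Hypotheses (cH : continuous H) (bH : bounded_fun H) (hbeta : Cb EY beta).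

Lemma continuous_section1 x : continuous (fun y => H (x, y)).
Proof.
move=> y; apply: (@continuous_comp _ _ _ (fun y' => (x, y')) H y); last exact: cH.
by apply: cvg_pair; [exact: cvg_cst|exact: cvg_id].
Qed.

Lemma continuous_section2 y : continuous (fun x => H (x, y)).
Proof.
move=> x; apply: (@continuous_comp _ _ _ (fun x' => (x', y)) H x); last exact: cH.
by apply: cvg_pair; [exact: cvg_id|exact: cvg_cst].
Qed.

Lemma mp_expectation_span_le (X : markovProcess EX) x s n (c : 'I_n -> R)
    (y : 'I_n -> EY) (b : R) : 0 <= s ->
  (forall x', \sum_(i < n) c i * H (x', y i) <= b) ->
  \sum_(i < n) c i * mp_expectation X x (fun w => H (mp_path s w, y i)) <= b.
Proof.
move=> s0 Hb; have [M [M0 HM]] := bounded_fun_le bH.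
have iH i : (mp_law X x).-integrable setT
    (EFin \o (fun w => H (mp_path s w, y i))).
  apply: (@probability_bounded_integrable _ _ _ _ _ M) => //.
  apply: (measurableT_comp
    (continuous_borel_measurable (@continuous_section2 (y i)))).
  exact: mp_process.
have icH i : (mp_law X x).-integrable setT
    (EFin \o (fun w => c i * H (mp_path s w, y i))).
  exact: (integrableZl measurableT (c i) (iH i)).
have -> :
    \sum_(i < n) c i * mp_expectation X x (fun w => H (mp_path s w, y i)) =
    \int[mp_law X x]_w (\sum_(i < n) c i * H (mp_path s w, y i)).
  rewrite (Rintegral_sum measurableT _ icH); apply: eq_bigr => i _.
  by rewrite RintegralZl.
have -> : b = \int[mp_law X x]_w b.
  rewrite Rintegral_cst// [X in fine X](_ : _ = 1%E) ?mulr1//.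
  exact: probability_setT.
apply: le_Rintegral => //.
  exact: (integrable_sum_EFin measurableT _ icH).
by apply: (@probability_bounded_integrable _ _ _ _ _ `|b|).
Qed.

Variables (Y : markovProcess EY) (Xn : nat -> markovProcess EX)
  (Yn : nat -> markovProcess EY).
Hypothesis dual : forall n, dual_with_potential H beta (Xn n) (Yn n).
Hypothesis cvgY : cvg_in_distribution Yn Y.

(** For s >= 0 the combination h of the Feynman-Kac expectations of Yn m is, by
    duality, the expectation of a function of Xn m bounded by b.  So its
    integral over [a, r] is at most b (r - a), and this bound passes to the
    limit Y, as the integral is a combination of expectations of Skorokhod
    continuous functionals.  A value of h above b at time t would by
    right-continuity persist on some [t, r], against the bound for the
    integral. *)
Lemma feynman_kac_span_le x n (c : 'I_n -> R) (y : 'I_n -> EY) (b t : R) :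
  0 <= t -> (forall x', \sum_(i < n) c i * H (x', y i) <= b) ->
  \sum_(i < n) c i * feynman_kac Y beta (fun y' => H (x, y')) t (y i) <= b.
Proof.
move=> t0 Hb; have [M [M0 HM]] := bounded_fun_le bH.
have [B [B0 betaB]] := bounded_fun_le hbeta.2.
have cbeta := hbeta.1.
pose g y' := H (x, y'); have cg : continuous g by exact: continuous_section1.
have gM y' : `|g y'| <= M by exact: HM.
have [cYn cYp cvgPhi] := cvgY.
pose h (Z : markovProcess EY) s :=
  \sum_(i < n) c i * mean_weight Z beta g (y i) s.
pose Phi a r (w : R -> EY) :=
  \int[lebesgue_measure]_(s in `[a, r]) path_weight beta g w s.
have ih (Z : markovProcess EY) a r i :
    (forall o : mp_space Z, cadlag (fun t => mp_path t o)) -> 0 <= r ->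
    (@lebesgue_measure R).-integrable `[a, r]
      (EFin \o (fun s => mean_weight Z beta g (y i) s)).
  move=> cZ r0; apply: (@bounded_integrable_itv _ _ _ _ (M * expR (B * r))).
    exact: (measurable_mean_weight cZ cbeta cg betaB gM).
  move=> s; rewrite in_itv/= => /andP[_ sr].
  exact: (mean_weight_le cZ cbeta cg betaB gM).
have ich (Z : markovProcess EY) a r i :
    (forall o : mp_space Z, cadlag (fun t => mp_path t o)) -> 0 <= r ->
    (@lebesgue_measure R).-integrable `[a, r]
      (EFin \o (fun s => c i * mean_weight Z beta g (y i) s)).
  by move=> cZ r0; exact: (integrableZl _ (c i) (ih Z a r i cZ r0)).
have PhiE (Z : markovProcess EY) a r :
    (forall o : mp_space Z, cadlag (fun t => mp_path t o)) -> 0 <= r ->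
    \sum_(i < n) c i * mp_expectation Z (y i)
      (fun o => Phi a r (fun t => mp_path t o)) =
    \int[lebesgue_measure]_(s in `[a, r]) h Z s.
  move=> cZ r0; rewrite /h (Rintegral_sum _ _ (fun i => ich Z a r i cZ r0))//.
  apply: eq_bigr => i _; rewrite RintegralZl//; last exact: ih.
  by rewrite (mean_integral_weight cZ cbeta cg betaB gM).
have hn_le m s : 0 <= s -> h (Yn m) s <= b.
  move=> s0; rewrite /h.
  under eq_bigr do rewrite -feynman_kacE// -dual//.
  exact: mp_expectation_span_le.
have h_cvg s : h Y r @[r --> s^'+] --> h Y s.
  apply: cvg_ord_sum => i; apply: cvgMl_tmp.
  exact: (cvg_mean_weight cYp cbeta cg betaB gM).
have int_le a r : 0 <= a <= r ->
    \int[lebesgue_measure]_(s in `[a, r]) h Y s <= b * (r - a).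
  move=> /andP[a0 ar]; have r0 := le_trans a0 ar.
  rewrite -PhiE//.
  have : \sum_(i < n) c i * mp_expectation (Yn m) (y i)
      (fun o => Phi a r (fun t => mp_path t o)) @[m --> \oo] -->
      \sum_(i < n) c i * mp_expectation Y (y i)
      (fun o => Phi a r (fun t => mp_path t o)).
    apply: cvg_ord_sum => i; apply: cvgMl_tmp; apply: cvgPhi.
      by apply: (skorokhod_continuous_path_weight cbeta cg betaB gM); rewrite a0.
    exists (M * expR (B * r) * (r - a)) => w cw.
    apply: norm_Rintegral_itv_le => //.
      exact: (measurable_path_weight cbeta cg betaB).
    move=> s; rewrite in_itv/= => /andP[_ sr].
    exact: (path_weight_le cbeta betaB gM).
  move=> /cvgr_to_le; apply; apply: nearW => m; rewrite PhiE//.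
  have ibr : (@lebesgue_measure R).-integrable `[a, r] (EFin \o (fun=> b)).
    by apply: (@bounded_integrable_itv _ _ _ _ `|b|).
  rewrite -(fine_lebesgue_measure_itv ar) -Rintegral_cst//.
  apply: le_Rintegral => //.
    by apply: (integrable_sum_EFin _ _
      (fun i => ich (Yn m) a r i (cYn m) r0)).
  by move=> s; rewrite /= in_itv/= => /andP[/(le_trans a0) s0 _]; exact: hn_le.
rewrite leNgt; apply/negP.
under eq_bigr do rewrite feynman_kacE//.
rewrite -/(h Y t) => bh.
pose e := (h Y t - b) / 2; have e0 : 0 < e by rewrite divr_gt0// subr_gt0.
have /cvgrPdist_lt/(_ _ e0)[d /= d0 hd] := h_cvg t.
have he : h Y t = b + e + e by rewrite -addrA /e -splitr addrC subrK.
pose r := t + d / 2.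
have tr : t < r by rewrite ltrDl divr_gt0.
have h_ge s : s \in `[t, r] -> b + e <= h Y s.
  rewrite in_itv/= le_eqVlt => /andP[/predU1P[<- _|ts sr]].
    by rewrite he lerDl ltW.
  have := hd s; rewrite /ball_/= => /(_ _ ts).
  have : `|t - s| < d by rewrite distrC gtr0_norm ?subr_gt0// /r in sr *; lra.
  move=> sd /(_ sd) /(le_lt_trans (ler_norm _)).
  by rewrite ltrBlDl he ltrD2r => /ltW.
have := int_le t r; rewrite t0 ltW// => /(_ isT); apply/negP; rewrite -ltNge.
apply: (@lt_le_trans _ _ ((b + e) * (r - t))).
  by rewrite ltr_pM2r ?subr_gt0// ltrDl.
rewrite -(fine_lebesgue_measure_itv (ltW tr)) -Rintegral_cst//.
apply: le_Rintegral => //.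
- by apply: (@bounded_integrable_itv _ _ _ _ `|b + e|).
- by apply: (integrable_sum_EFin _ _
    (fun i => ich Y t r i cYp (le_trans t0 (ltW tr)))).
Qed.

End duality_bounds.

(** * The limit semigroup and its kernels *)

Theorem corollary2p7 (R : realType) (EX EY : polishType R)
    (H : EX * EY -> R) (hHc : continuous H) (hHb : bounded_fun H)
    (HX : set (EX -> R)) (hHX : HX = range (fun y x => H (x, y)))
    (HY : set (EY -> R)) (hHY : HY = range (fun x y => H (x, y)))
    (GY : (EY -> R) -> (EY -> R)) (hGY : forall f, HY f -> Cb EY (GY f))
    (beta : EY -> R) (hbeta : Cb EY beta)
    (Y : markovProcess EY)
    (hYcont : strongly_continuous (mp_semigroup Y))
    (hYmp : forall y : EY,
      unique_solution_martingale_problem GY HY y (mp_law Y y) (@mp_path R EY Y))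
    (P : R -> (EX -> R) -> (EX -> R))
    (hPsemi : semigroup (bp_closure (linear_span HX)) P)
    (hP : forall (t : R) (x : EX) (y : EY), 0 <= t ->
      P t (fun x' => H (x', y)) x =
      feynman_kac Y beta (fun y' => H (x, y')) t y)
    (hdom : HX `<=` generator_dom (bp_closure (linear_span HX)) P)
    (hgen : forall (x : EX) (y : EY),
      generator P (fun x' => H (x', y)) x =
      GY (fun y' => H (x, y')) y + beta y * H (x, y))
    (hEX : compact [set: EX])
    (halg : algebra_on (linear_span HX))
    (hone : linear_span HX (fun=> 1))
    (hdet : convergence_determining (linear_span HX))
    (hFeller : Feller (mp_semigroup Y))
    (Xn : nat -> markovProcess EX) (Yn : nat -> markovProcess EY)
    (hdual : forall n, dual_with_potential H beta (Xn n) (Yn n))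
    (hcvg : cvg_in_distribution Yn Y) :
  (forall (t : R) (x : EX), 0 <= t ->
    [/\ linear_on (V := R^o) (linear_span HX) (fun f => P t f x),
        positive_functional (linear_span HX) (fun f => P t f x) &
        P t (fun=> 1) x = 1]) /\
  exists mu : R -> R.-pker (borel EX) ~> (borel EX),
    forall (y : EY) (t : R), 0 <= t ->
      P t (fun x => H (x, y)) = (fun x => \int[mu t x]_x' H (x', y)).
Proof.
have [[vD DCb] PBb Plin _ _] := hPsemi.
set A := linear_span HX in halg hone hdet Plin PBb vD DCb *.
set D := bp_closure A in Plin PBb vD DCb *.
have AD : A `<=` D by exact: sub_bp_closure.
have Px_lin t x : 0 <= t -> linear_on (V := R^o) D (fun f => P t f x).
  by move=> t0 a f g Df Dg; rewrite /= Plin.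
have P_le t x f b : 0 <= t -> A f -> (forall x', f x' <= b) -> P t f x <= b.
  move=> t0 [n [c [g [HXg ->]]]] fb.
  have /choice[y yE] i : exists y, g i = fun x' => H (x', y).
    by move: (HXg i); rewrite hHX => -[y _ <-]; exists y.
  have Dg i : D (g i) by apply: AD; exact/sub_linear_span/HXg.
  rewrite (linear_on_sum c vD (Px_lin t x t0) Dg).2.
  under eq_bigr do rewrite yE hP//.
  apply: (feynman_kac_span_le hHc hHb hbeta hdual hcvg) => // x'.
  apply: le_trans (fb x'); rewrite le_eqVlt; apply/orP; left; apply/eqP.
  by apply: eq_bigr => i _; rewrite yE.
have P_ge t x f b : 0 <= t -> A f -> (forall x', b <= f x') -> b <= P t f x.
  move=> t0 Af bf; have AN := vector_spaceZ (-1) halg.1 Af.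
  have := P_le t x _ (- b) t0 AN.
  rewrite (linear_onZ _ vD (Px_lin t x t0) (AD _ Af)) mulN1r.
  rewrite lerN2; apply => x'; rewrite mulN1r lerN2; exact: bf.
have P1 t x : 0 <= t -> P t (fun=> 1) x = 1.
  by move=> t0; apply/eqP; rewrite eq_le P_le//= P_ge.
have Ppos t x : 0 <= t -> positive_functional A (fun f => P t f x).
  by move=> t0 f Af f0; exact: P_ge.
have PxA_lin t x : 0 <= t -> linear_on (V := R^o) A (fun f => P t f x).
  by move=> t0 a f g /AD Df /AD Dg; exact: Px_lin.
split; first by move=> t x t0; split; [exact: PxA_lin|exact: Ppos|exact: P1].
(* Negative times, which carry no condition, receive the kernel of time 0. *)
have /choice[mu muE] t : exists k : R.-pker (borel EX) ~> (borel EX),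
    0 <= t -> forall x f, A f -> \int[k x]_x' f x' = P t f x.
  have t0 : 0 <= Num.max t 0 by rewrite le_max lexx orbT.
  have [||||k kE] := @kernel_representation R EX _ (borel EX) A
    (fun x f => P (Num.max t 0) f x) hEX halg hone hdet.
  - by move=> x; exact: PxA_lin.
  - by move=> x; exact: Ppos.
  - by move=> x; exact: P1.
  - by move=> f /AD Df; have [] := PBb _ _ t0 Df.
  by exists k => t_ge0 x f Af; rewrite kE// max_l.
exists mu => y t t0; apply/funext => x.
rewrite muE//; apply: sub_linear_span.
by rewrite hHX; exists y.
Qed.
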